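(* Let $F=\{\mathbf{p}_0,\ldots,\mathbf{p}_n\}\subset\mathbb{R}^d$ be not contained in any $(d-1)$-dimensional affine subspace and consider the homogeneous IFS $S_i(\mathbf{x})=\lambda\mathbf{x}+(1-\lambda)\mathbf{p}_i$, $i=0,\ldots,n$, with $\lambda\in(2^{-1/(2d)},1)$ and $\lambda^{-2d}$ not a Pisot number. If every $\mathbf{x}\in\mathrm{int}(X)$ lies in $\mathrm{int}(\mathrm{conv}(B))$ for some $B\subseteq F$ consisting of $d+1$ points not contained in any $(d-1)$-dimensional affine subspace, then $\mathrm{int}(X)=X_{uni}$.
   Context: $\mathcal{D}=\{0,\ldots,n\}$. $X$ is the unique non-empty compact set with $X=\bigcup_{i\in\mathcal{D}}S_i(X)$, $\mathrm{int}$ denotes interior in $\mathbb{R}^d$ and $\mathrm{conv}$ convex hull. The coding map is $\pi(\mathbf{a})=\lim_{j\to\infty}(S_{a_1}\circ\cdots\circ S_{a_j})(\mathbf{0})$. A sequence in $\mathcal{D}^{\mathbb{N}}$ is universal if it contains every finite word over $\mathcal{D}$ as a block of consecutive digits; $X_{uni}$ is the set of $\mathbf{x}\in X$ with a universal $\mathbf{a}$ satisfying $\pi(\mathbf{a})=\mathbf{x}$. A Pisot number is a real algebraic integer $>1$ all of whose Galois conjugates have modulus strictly less than $1$. *)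

(* Defs.v *)
From HB Require Import structures.
From mathcomp Require Import all_boot all_order all_algebra.
From mathcomp Require Import all_classical all_reals all_analysis.
From mathcomp Require Import complex.
Set Implicit Arguments. Unset Strict Implicit. Unset Printing Implicit Defensive.
Import Order.TTheory GRing.Theory Num.Theory.
Import numFieldNormedType.Exports.
Local Open Scope classical_set_scope.
Local Open Scope ring_scope.

Section Defs.
Variable R : realType.
Variable d : nat.
Notation V := 'rV[R]_d.

Definition in_hyperplane (A : set V) : Prop :=
  exists (a : V) (c : R), a != 0 /\
    forall x, A x -> \sum_(k < d) a 0 k * x 0 k = c.

Definition convex_set_of (C : set V) : Prop :=
  forall x y (t : R), C x -> C y -> 0 <= t -> t <= 1 ->
    C (t *: x + (1 - t) *: y).

Definition chull (A : set V) : set V :=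
  \bigcap_(C in [set C : set V | A `<=` C /\ convex_set_of C]) C.

Variable n : nat.
Definition S (lam : R) (p : 'I_n.+1 -> V) (i : 'I_n.+1) (x : V) : V :=
  lam *: x + (1 - lam) *: p i.

Definition is_attractor (lam : R) (p : 'I_n.+1 -> V) (X : set V) : Prop :=
  X !=set0 /\ compact X /\
  X = \bigcup_(i in [set: 'I_n.+1]) (S lam p i @` X).

(* (S_{a_1} o ... o S_{a_j})(x), sequences indexed from 0 *)
Definition Scomp (lam : R) (p : 'I_n.+1 -> V) (a : nat -> 'I_n.+1)
  (j : nat) (x : V) : V :=
  foldr (fun k y => S lam p (a k) y) x (iota 0 j).

Definition coding (lam : R) (p : 'I_n.+1 -> V) (a : nat -> 'I_n.+1) : V :=
  lim ((fun j => Scomp lam p a j 0) @ \oo).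

Definition universal (a : nat -> 'I_n.+1) : Prop :=
  forall w : seq 'I_n.+1, exists k : nat,
    forall i, (i < size w)%N -> a (k + i)%N = nth ord0 w i.

Definition X_uni (lam : R) (p : 'I_n.+1 -> V) (X : set V) : set V :=
  [set x | X x /\ exists a, universal a /\ coding lam p a = x].

End Defs.

Definition algebraic_integer (R : realType) (x : R) : Prop :=
  exists q : {poly int}, q \is monic /\ root (map_poly intr q) x.

Definition minimal_polynomial (R : realType) (x : R) (p : {poly rat}) : Prop :=
  p \is monic /\ irreducible_poly p /\ root (map_poly ratr p) x.

Definition pisot (R : realType) (x : R) : Prop :=
  1 < x /\ algebraic_integer x /\
  exists p : {poly rat}, minimal_polynomial x p /\
    forall z : R[i], root (map_poly ratr p) z -> z != (x%:C)%C -> `|z| < 1.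

(* Main.v *)
(* Undoing the maps [S i] multiplies barycentric coordinates by [q = 1 / lam], so steering
   a point of [interior X] with [2 d] consecutive levels per block amounts to choosing
   0-1 words in base [Q = q ^ (2 d) < 2], two for each coordinate. When [Q] is not Pisot,
   differences of values of 0-1 words in base [Q] are arbitrarily small: otherwise a
   window of length 1 with a maximal number of values makes [Q] an algebraic integer, and
   a maximum principle on the values of words at a conjugate outside the open unit disc
   forces this conjugate to be [Q]. Small differences give words whose values are dense
   in a long interval, and the second word of each coordinate translates this interval, so
   an orbit of every interior point comes as close as desired to any target. Aiming
   successively at the images of an interior point under all finite words produces a
   universal coding; conversely a universal coding passes through a cylinder contained in
   [interior X], which is not empty because a simplex lies in [X]. *)

Require Import Defs.
From HB Require Import structures.
From mathcomp Require Import all_boot all_order all_algebra.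
From mathcomp Require Import all_classical all_reals all_analysis.
From mathcomp Require Import complex.
From mathcomp Require Import zify ring lra.
Import Order.TTheory GRing.Theory Num.Theory.
Import numFieldNormedType.Exports.
Local Open Scope classical_set_scope.
Local Open Scope ring_scope.

Set Implicit Arguments.
Unset Strict Implicit.

(** Two words per coordinate are needed because words of bounded length are dense only in a bounded
    interval, while undoing [N] blocks carries a coordinate to the order of [Q ^+ N]. The values of
    the second word have gaps less than 1, as [Q < 2], and bring the remainder back into that
    interval.

    In the lemmas on small differences the letter [q] is the block base [Q]. There, for a small
    nonnegative difference [y] of values at [q] whose counterpart at a conjugate [alpha] is [y'],
    the maximum principle shows that [z = alpha ^+ s * y' - q ^+ s * y] is 0; a nonzero difference
    admitting two successive [s] then gives [alpha = q]. A word that maximises a linear functional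
    is compared with a competitor: the functional stays bounded, but gains the real part of
    [theta * alpha ^+ i * z] with a free unit factor [theta]. Outside the closed disc this gain is
    unbounded in [i]. The obstacle is the unit circle, where the gain is bounded: there the two
    words must disagree again and again, and since [alpha] is no root of unity the disagreements
    accumulate too much energy. *)

(** * Digit sums and greedy expansions *)

Definition ev (A : nzRingType) (x : A) (s : seq bool) : A :=
  foldr (fun (b : bool) acc => b%:R + x * acc) 0 s.

Section DigitSums.
Variables (A : comNzRingType) (x : A).

Lemma ev_cat s t : ev x (s ++ t) = ev x s + x ^+ size s * ev x t.
Proof.
elim: s => [|b s IH] /=; first by rewrite add0r expr0 mul1r.
by rewrite IH exprS; ring.
Qed.

Lemma ev_rcons s b : ev x (rcons s b) = ev x s + x ^+ size s * b%:R.
Proof. by rewrite -cats1 ev_cat /= mulr0 addr0. Qed.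

Lemma ev_nseq0 m : ev x (nseq m false) = 0.
Proof. by elim: m => //= m ->; rewrite mulr0 addr0. Qed.

Lemma ev_sum s : ev x s = \sum_(k < size s) (nth false s k)%:R * x ^+ k.
Proof.
elim: s => [|b s IH] /=; first by rewrite big_ord0.
rewrite big_ord_recl /= expr0 mulr1 IH mulr_sumr; congr (_ + _).
by apply: eq_bigr => k _; rewrite exprS; ring.
Qed.

Lemma ev_nseq1 m : (x - 1) * ev x (nseq m true) = x ^+ m - 1.
Proof.
elim: m => [|m IH] /=; first by rewrite mulr0 expr0 subrr.
by rewrite mulrDr mulrCA IH exprS; ring.
Qed.

End DigitSums.

Lemma ev_ge0 (R : realFieldType) (q : R) s : 0 <= q -> 0 <= ev q s.
Proof. by move=> q0; elim: s => //= b s IH; rewrite addr_ge0 ?mulr_ge0. Qed.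

Lemma ev_le_ones (R : realFieldType) (q : R) s : 0 <= q ->
  ev q s <= ev q (nseq (size s) true).
Proof.
move=> q0; elim: s => //= b s IH; rewrite lerD ?ler_wpM2l //.
by rewrite ler_nat; case: b.
Qed.

Lemma ev_onesE (R : realFieldType) (q : R) m : 1 < q ->
  ev q (nseq m true) = (q ^+ m - 1) / (q - 1).
Proof.
by move=> q1; rewrite -(ev_nseq1 q m) mulrAC divff ?mul1r //; apply: lt0r_neq0; lra.
Qed.

(* Greedy expansion from the top digit; [q <= 2] closes the gap between
   [ev q (nseq b true)] and [q ^+ b]. *)
Lemma ev_gap (R : realFieldType) (q : R) b y : 1 < q -> q <= 2 ->
  0 <= y -> y <= ev q (nseq b true) ->
  exists v, [/\ size v = b, ev q v <= y & y < ev q v + 1].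
Proof.
move=> q1 q2; have q0 : 0 <= q by lra.
elim: b y => [|b IH] y y0.
  by move=> /= y1; exists [::]; rewrite /=; split=> //; lra.
rewrite -addn1 nseqD ev_cat /= size_nseq mulr0 addr0 mulr1 => yT.
have [yq|yq] := leP (q ^+ b) y.
  have [||v [sv v1 v2]] := IH (y - q ^+ b); [lra | lra |].
  by exists (rcons v true); rewrite size_rcons sv addn1 ev_rcons sv mulr1; split=> //; lra.
have [yb|yb] := leP y (ev q (nseq b true)).
  have [//||v [sv v1 v2]] := IH y; first by [].
  by exists (rcons v false); rewrite size_rcons sv addn1 ev_rcons sv mulr0 addr0.
exists (rcons (nseq b true) false).
rewrite size_rcons size_nseq addn1 ev_rcons mulr0 addr0; split=> //; first exact: ltW.
apply: (lt_le_trans yq); have := ev_nseq1 q b; have := ev_ge0 (nseq b true) q0.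
by move: (ev q _) (q ^+ b) => T Q T0 TQ; nra.
Qed.

Lemma expr_unbounded (R : realType) (q M : R) : 1 < q ->
  exists b0, forall b, (b0 <= b)%N -> M < q ^+ b.
Proof.
move=> q1; have Mq : 0 <= `|M| / (q - 1) by rewrite divr_ge0 //; lra.
exists (Num.bound (`|M| / (q - 1))) => b hb.
have h1 : `|M| / (q - 1) < b%:R.
  by apply: lt_le_trans (archi_boundP Mq) _; rewrite ler_nat.
rewrite ltr_pdivrMr ?subr_gt0 // in h1.
have h2 : 1 + b%:R * (q - 1) <= q ^+ b.
  elim: b {hb h1} => [|b IH]; first by rewrite mul0r addr0 expr0.
  rewrite exprS -natr1; have B0 : 0 <= b%:R :> R by [].
    have := ler_wpM2l (ltW (lt_trans ltr01 q1)) IH.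
    have := mulr_ge0 B0 (sqr_ge0 (q - 1)).
    by move: (b%:R : R) (q ^+ b) {IH B0} => B Qb h1 h2; lra.
by have := ler_norm M; lra.
Qed.

(** * Separated values and windows of length 1 *)

Definition separated (R : realType) (q delta : R) :=
  forall u v, `|ev q u - ev q v| < delta -> ev q u = ev q v.

Definition value_window (R : realType) (q : R) (N : nat) : Prop :=
  exists (t : R) (ss : seq (seq bool)),
  [/\ 0 <= t, size ss = N, uniq (map (ev q) ss) &
      {in ss, forall s, t - 1 < ev q s <= t}].

(** Pigeonhole: separation puts distinct values into distinct cells of width [delta], and the window
    meets at most [(Num.truncn delta^-1).+1] of them. *)
Lemma value_window_bound (R : realType) (q delta : R) : 0 < delta ->
  separated q delta -> exists M, forall N, value_window q N -> (N <= M)%N.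
Proof.
move=> delta0 sep; have i0 : 0 < delta^-1 by rewrite invr_gt0.
exists (Num.truncn delta^-1).+1 => N [t [ss [_ <- us wss]]].
pose g (s : R) := Num.truncn ((s - (t - 1)) / delta).
have gE s : s \in map (ev q) ss -> (g s)%:R <= (s - (t - 1)) / delta < (g s).+1%:R.
  move=> /mapP[{}s /wss /andP[h1 h2] ->]; apply: truncn_itv.
  by rewrite divr_ge0 ?(ltW delta0) //; lra.
have ug : uniq (map g (map (ev q) ss)).
  rewrite map_inj_in_uniq // => s s' hs hs' gss.
  have /andP[a1 a2] := gE _ hs; have /andP[b1 b2] := gE _ hs'.
  rewrite -gss in b1 b2; rewrite -natr1 in a2 b2.
  have /mapP[u _ su] := hs; have /mapP[u' _ su'] := hs'.
  rewrite su su'; apply: sep; rewrite -su -su'.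
  rewrite -(ltr_pM2r i0) divff ?gt_eqF //.
  have -> : `|s - s'| / delta = `|(s - s') / delta| by rewrite normrM (gtr0_norm i0).
  by rewrite ltr_norml; apply/andP; split; lra.
rewrite -(size_map (ev q)) -(size_map g) -(size_iota 0 (Num.truncn delta^-1).+1).
apply: uniq_leq_size => // k /mapP[s /mapP[u hu ->] ->]; rewrite mem_iota /= add0n ltnS.
have /andP[h1 h2] := wss _ hu.
rewrite /g; apply: le_truncn; rewrite ler_pdivrMr // mulVf ?gt_eqF //; lra.
Qed.

Lemma max_value_window (R : realType) (q delta : R) : 0 < delta ->
  separated q delta -> exists N, value_window q N /\
    forall N', value_window q N' -> (N' <= N)%N.
Proof.
move=> delta0 sep; have [M hM] := value_window_bound delta0 sep.
have ex : exists N, `[< value_window q N >].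
  by exists 0%N; apply/asboolP; exists 0, [::].
have ub N : `[< value_window q N >] -> (N <= M)%N by move/asboolP/hM.
case: (ex_maxnP ex ub) => N /asboolP hN mN; exists N; split => // N' hN'.
by apply: mN; apply/asboolP.
Qed.

Definition word_pad b (s : seq bool) := s ++ nseq (b - size s) false.

Lemma ev_pad (A : comNzRingType) (x : A) b s : ev x (word_pad b s) = ev x s.
Proof. by rewrite ev_cat ev_nseq0 mulr0 addr0. Qed.

Lemma size_pad b s : (size s <= b)%N -> size (word_pad b s) = b.
Proof. by move=> h; rewrite size_cat size_nseq subnKC. Qed.

(* Feng's argument: a window of length 1 containing a maximal number of values
   gains no value when all its words are continued by a common word. *)
Lemma common_extension (R : realType) (q delta : R) : 1 < q -> q < 2 ->
  0 < delta -> separated q delta -> exists b, forall u v,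
    0 <= ev q u - ev q v -> ev q u - ev q v <= 1 ->
    exists s' v', [/\ size s' = b, size v' = b & ev q (v' ++ v) = ev q (s' ++ u)].
Proof.
move=> q1 q2 delta0 sep; have q0 : 0 <= q by lra.
have [N [[t [ss [t0 sN us wss]]] mN]] := max_value_window delta0 sep.
pose m := (\max_(s <- ss) size s)%N.
have q21 : 0 < (2 - q) by lra.
(* Beyond this threshold [q ^+ b * (2 - q)] exceeds [1 + t], so [b] ones are worth at least
   [t + q ^+ b], and the greedy expansion reaches its target for every difference up to 1. *)
have [b1 hb1] := @expr_unbounded R q ((1 + t) / (2 - q)) q1.
pose b := maxn m b1; exists b => u v uv0 uv1.
have Tb : t + q ^+ b <= ev q (nseq b true).
  have := hb1 b (leq_maxr _ _); rewrite ltr_pdivrMr // => hb.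
  have := ev_nseq1 q b; have := ev_ge0 (nseq b true) q0.
  have : 0 <= q ^+ b by rewrite exprn_ge0.
  by move: (ev q _) (q ^+ b) hb => T Q; nra.
have qb0 : 0 <= q ^+ b by rewrite exprn_ge0.
have [||v' [sv' v1 v2]] := @ev_gap R q b (t + q ^+ b * (ev q u - ev q v)) q1 (ltW q2).
- by rewrite addr_ge0 ?mulr_ge0.
- by apply: le_trans Tb; rewrite lerD2l ler_piMr.
have sz s : s \in ss -> (size s <= b)%N.
  move=> hs; apply: leq_trans (leq_maxl _ _); rewrite /m.
  by rewrite (big_rem s) //= leq_maxl.
suff [s hs evs] : exists2 s, s \in ss & ev q (v' ++ v) = ev q (word_pad b s ++ u).
  by exists (word_pad b s), v'; rewrite size_pad ?sz.
apply: contrapT => nex.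
pose ss' := (v' ++ v) :: map (fun s => word_pad b s ++ u) ss.
have : value_window q (size ss').
  exists (t + q ^+ b * ev q u), ss'; split=> //.
  - by rewrite addr_ge0 // mulr_ge0 // ev_ge0.
  - rewrite /= -map_comp; apply/andP; split.
      apply/negP => /mapP[s hs /= e]; apply: nex; exists s => //.
    have -> : map (ev q \o (fun s => word_pad b s ++ u)) ss
       = map (fun x => x + q ^+ b * ev q u) (map (ev q) ss).
      rewrite -map_comp; apply/eq_in_map => s hs /=.
      by rewrite ev_cat ev_pad size_pad ?sz.
    by rewrite map_inj_uniq // => x y /addIr.
  move=> s; rewrite inE => /orP[/eqP ->|/mapP[{}s hs ->]].
    rewrite ev_cat sv'; move: v1 v2 => v1 v2.
    by apply/andP; split; lra.
  rewrite ev_cat ev_pad size_pad ?sz //.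
  by have /andP[h1 h2] := wss _ hs; apply/andP; split; lra.
by move/mN; rewrite /= size_map sN ltnn.
Qed.

(** * The modulus of complex numbers and conjugate digit sums *)

Notation nrm := (@ComplexField.Normc.normc _).
Notation cRe := (@complex.Re _).
Notation cIm := (@complex.Im _).

Section ComplexModulus.
Variable R : realType.
Implicit Types z w : R[i].

Lemma cReD z w : cRe (z + w) = cRe z + cRe w. Proof. by case: z; case: w. Qed.
Lemma cReN z : cRe (- z) = - cRe z. Proof. by case: z. Qed.
Lemma cReB z w : cRe (z - w) = cRe z - cRe w. Proof. by rewrite cReD cReN. Qed.
Lemma cReM z w : cRe (z * w) = cRe z * cRe w - cIm z * cIm w.
Proof. by case: z; case: w. Qed.
Lemma cRe_realM (x : R) z : cRe (x%:C%C * z) = x * cRe z.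
Proof. by rewrite cReM /= mul0r subr0. Qed.
Lemma cRe_sum I (r : seq I) (P : pred I) (F : I -> R[i]) :
  cRe (\sum_(i <- r | P i) F i) = \sum_(i <- r | P i) cRe (F i).
Proof. by elim/big_rec2: _ => //= i x y _ <-; rewrite cReD. Qed.

Lemma nrm_def z : nrm z = Num.sqrt (cRe z ^+ 2 + cIm z ^+ 2). Proof. by case: z. Qed.
Lemma nrm_sqr z : nrm z ^+ 2 = cRe z ^+ 2 + cIm z ^+ 2.
Proof. by rewrite nrm_def sqr_sqrtr // addr_ge0 ?sqr_ge0. Qed.
Lemma nrm_ge0 z : 0 <= nrm z. Proof. by rewrite nrm_def sqrtr_ge0. Qed.
Lemma nrmM z w : nrm (z * w) = nrm z * nrm w. Proof. exact: ComplexField.Normc.normcM. Qed.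
Lemma nrm1 : nrm (1 : R[i]) = 1. Proof. exact: ComplexField.Normc.normc1. Qed.
Lemma nrm0 : nrm (0 : R[i]) = 0. Proof. exact: ComplexField.Normc.normc0. Qed.
Lemma nrmX z m : nrm (z ^+ m) = nrm z ^+ m.
Proof. by elim: m => [|m IH]; rewrite ?expr0 ?nrm1 // !exprS nrmM IH. Qed.
Lemma nrmD z w : nrm (z + w) <= nrm z + nrm w. Proof. exact: le_normcD. Qed.
Lemma nrmN z : nrm (- z) = nrm z. Proof. exact: normcN. Qed.
Lemma nrm_eq0 z : (nrm z == 0) = (z == 0).
Proof.
by apply/eqP/eqP => [/ComplexField.Normc.eq0_normc //|->]; rewrite nrm0.
Qed.
Lemma nrm_gt0 z : z != 0 -> 0 < nrm z.
Proof. by rewrite lt0r nrm_eq0 nrm_ge0 andbT. Qed.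
Lemma nrm_sum I (r : seq I) (P : pred I) (F : I -> R[i]) :
  nrm (\sum_(i <- r | P i) F i) <= \sum_(i <- r | P i) nrm (F i).
Proof.
elim/big_rec2: _ => [|i x y _ h]; first by rewrite nrm0.
by apply: le_trans (nrmD _ _) _; rewrite lerD2l.
Qed.
Lemma cRe_le_nrm z : cRe z <= nrm z.
Proof.
apply: le_trans (ler_norm _) _; rewrite nrm_def -sqrtr_sqr ler_wsqrtr //.
by rewrite lerDl sqr_ge0.
Qed.
Lemma nrm_real (x : R) : nrm (x%:C%C) = `|x|.
Proof. by rewrite nrm_def /= expr0n addr0 sqrtr_sqr. Qed.
Lemma abs_cRe_le_nrm z : `|cRe z| <= nrm z.
Proof. by rewrite ler_norml -[- _ <= _]lerN2 opprK -cReN -{1}nrmN !cRe_le_nrm. Qed.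

Lemma unit_direction z : z != 0 ->
  exists w, nrm w = 1 /\ cRe (w * z) = nrm z.
Proof.
move=> z0; have n0 := nrm_gt0 z0; exists ((nrm z)^-1%:C%C * conjc z); split.
  rewrite nrmM nrm_real ger0_norm ?invr_ge0 ?nrm_ge0 //.
  have -> : nrm (conjc z) = nrm z by case: z {z0 n0} => a b /=; rewrite sqrrN.
  by rewrite mulVf ?gt_eqF.
rewrite -mulrA cRe_realM.
have -> : cRe (conjc z * z) = nrm z ^+ 2.
  by rewrite nrm_sqr; case: z {z0 n0} => a b /=; ring.
by rewrite expr2 mulKf // gt_eqF.
Qed.
End ComplexModulus.

Section ConjugateDigits.
Variables (R : realType) (q : R) (alpha : R[i]).

Lemma nrm_ev_diff s t b : 1 <= nrm alpha -> size s = b -> size t = b ->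
  nrm (ev alpha s - ev alpha t) <= b%:R * nrm alpha ^+ b.
Proof.
move=> a1 ss st; rewrite !ev_sum ss st -sumrB.
apply: le_trans (nrm_sum _ _ _) _.
have -> : b%:R * nrm alpha ^+ b = \sum_(k < b) nrm alpha ^+ b.
  by rewrite sumr_const card_ord mulr_natl.
apply: ler_sum => k _; rewrite -mulrBl nrmM nrmX.
have h : nrm alpha ^+ k <= nrm alpha ^+ b by apply: ler_weXn2l => //; apply: ltnW.
apply: le_trans h; rewrite ler_piMl ?exprn_ge0 ?nrm_ge0 //.
by case: (nth _ s k); case: (nth _ t k); rewrite ?subrr ?subr0 ?sub0r ?nrmN ?nrm0 ?nrm1.
Qed.

(** Transferred to [alpha], a common extension reads [alpha ^+ b * (ev alpha u - ev alpha v) = ev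
    alpha v' - ev alpha s']. The right side has modulus at most [b%:R * nrm alpha ^+ b], and the
    power cancels; the bound is uniform because [b] does not depend on [u] and [v]. *)
Lemma conjugate_bound b : 1 <= nrm alpha ->
  (forall s t, ev q s = ev q t -> ev alpha s = ev alpha t) ->
  (forall u v, 0 <= ev q u - ev q v -> ev q u - ev q v <= 1 ->
    exists s' v', [/\ size s' = b, size v' = b & ev q (v' ++ v) = ev q (s' ++ u)]) ->
  forall u v, 0 <= ev q u - ev q v -> ev q u - ev q v <= 1 ->
    nrm (ev alpha u - ev alpha v) <= b%:R.
Proof.
move=> a1 H F u v h0 h1; have [s' [v' [ss sv e]]] := F u v h0 h1.
have := H _ _ e; rewrite !ev_cat ss sv => e'.
have ab : 0 < nrm alpha ^+ b by rewrite exprn_gt0 // (lt_le_trans ltr01).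
rewrite -(ler_pM2r ab) -{1}nrmX -nrmM; apply: le_trans (nrm_ev_diff a1 sv ss).
suff -> : (ev alpha u - ev alpha v) * alpha ^+ b = ev alpha v' - ev alpha s' by [].
rewrite mulrBl [ev alpha u * _]mulrC [ev alpha v * _]mulrC.
by apply/eqP; rewrite subr_eq addrAC e' addrAC subrr add0r.
Qed.

(* The functional [l k] vanishes at [k = i]; pairing the word [w] of its positive
   positions against any competitor [r] leaves a sum of nonnegative terms. *)
Lemma energy_identity theta i s u0 v0 w r (l : nat -> R) (kap y : R) (z : R[i]) :
  q != 0 ->
  kap = cRe (theta * alpha ^+ i) / q ^+ i ->
  (forall k, l k = cRe (theta * alpha ^+ k) - kap * q ^+ k) ->
  y = ev q u0 - ev q v0 ->
  z = alpha ^+ s * (ev alpha u0 - ev alpha v0) - (q ^+ s * y)%:C%C ->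
  size w = (i + s)%N -> size r = (i + s)%N ->
  (forall k, (k < i + s)%N -> nth false w k = (0 < l k)) ->
  cRe (theta * (ev alpha (w ++ u0) - ev alpha (r ++ v0)))
    - kap * (ev q (w ++ u0) - ev q (r ++ v0)) =
  \sum_(k < i + s) `|l k| * (nth false w k != nth false r k)%:R
    + cRe (theta * alpha ^+ i * z).
Proof.
move=> q0 kapE lE yE zE sw sr wE.
have lterm k : (k < i + s)%N -> `|l k| * (nth false w k != nth false r k)%:R =
   l k * ((nth false w k)%:R - (nth false r k)%:R).
  move=> kK; rewrite wE //; case: (ltP 0 (l k)) => h; case: (nth false r k) => /=;
  rewrite ?subrr ?mulr0 ?subr0 ?mulr1 ?sub0r ?mulrN1 //; [exact: gtr0_norm|exact: ler0_norm].
under eq_bigr => k _ do rewrite lterm // lE mulrBl.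
rewrite sumrB !ev_cat !(ev_sum _ w) !(ev_sum _ r) sw sr.
set W := (\sum_(k < i + s) _ * alpha ^+ k); set P := (\sum_(k < i + s) _ * alpha ^+ k).
set W' := (\sum_(k < i + s) _ * q ^+ k); set P' := (\sum_(k < i + s) _ * q ^+ k).
set E1 := (\sum_(k < i + s) _ * _); set E2 := (\sum_(k < i + s) _ * _).
have -> : E1 = cRe (theta * (W - P)).
  rewrite -sumrB mulr_sumr cRe_sum; apply: eq_bigr => k _.
  rewrite -mulrBl mulrCA.
  case: (nth false w k); case: (nth false r k);
    by rewrite ?subrr ?subr0 ?sub0r ?mulr0 ?mul0r ?mulr1 ?mul1r ?mulN1r ?mulrN1 ?cReN.
have -> : E2 = kap * (W' - P').
  by rewrite -sumrB mulr_sumr; apply: eq_bigr => k _; ring.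
have -> : cRe (theta * alpha ^+ i * z) =
   cRe (theta * alpha ^+ (i + s) * (ev alpha u0 - ev alpha v0)) - kap * q ^+ (i + s) * y.
  rewrite zE mulrBr cReB [theta * alpha ^+ i * _%:C%C]mulrC cRe_realM; congr (_ - _).
    by congr (cRe _); rewrite exprD; ring.
  rewrite exprD kapE; field; exact: expf_neq0.
have -> : theta * (W + alpha ^+ (i + s) * ev alpha u0 - (P + alpha ^+ (i + s) * ev alpha v0))
  = theta * (W - P) + theta * alpha ^+ (i + s) * (ev alpha u0 - ev alpha v0) by ring.
by rewrite cReD yE; ring.
Qed.

End ConjugateDigits.

Lemma ev_missing_digit (R : realFieldType) (q : R) w i : 0 <= q ->
  (i < size w)%N -> nth false w i = false ->
  ev q w + q ^+ i <= ev q (nseq (size w) true).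
Proof.
move=> q0 iw wi; rewrite !ev_sum size_nseq.
rewrite [X in _ <= X](bigD1 (Ordinal iw)) //= (bigD1 (Ordinal iw)) //= wi.
set A := (\sum_(_ < _ | _) _); set B := (\sum_(_ < _ | _) _).
have AB : A <= B.
  apply: ler_sum => k _; rewrite ler_wpM2r ?exprn_ge0 // nth_nseq ltn_ord.
  by case: (nth _ _ _).
by rewrite nth_nseq iw mulr0n mulr1n; lra.
Qed.

(** The zero digit of [w] at [i] leaves room [q ^+ i] below the word of ones, and the difference of
    the tails contributes at most that much; the greedy expansion can therefore absorb it. *)
Lemma competitor (R : realFieldType) (q : R) w i s u0 v0 : 1 < q -> q <= 2 ->
  size w = (i + s)%N -> (i < i + s)%N -> nth false w i = false ->
  0 <= ev q u0 - ev q v0 -> q ^+ s * (ev q u0 - ev q v0) <= 1 ->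
  exists r, [/\ size r = (i + s)%N, 0 <= ev q (w ++ u0) - ev q (r ++ v0) &
     ev q (w ++ u0) - ev q (r ++ v0) <= 1].
Proof.
move=> q1 q2 sw iis wi y0 y1; have q0 : 0 <= q by lra.
have [||r [sr r1 r2]] := @ev_gap R q (i + s)%N
   (ev q w + q ^+ (i + s) * (ev q u0 - ev q v0)) q1 q2.
- by rewrite addr_ge0 ?ev_ge0 // mulr_ge0 // exprn_ge0.
- rewrite -sw in iis *; have := ev_missing_digit q0 iis wi; rewrite sw.
  rewrite exprD -mulrA; have : 0 <= q ^+ i by rewrite exprn_ge0.
  move=> qi0 h; apply: le_trans h; rewrite lerD2l ler_piMr //.
exists r; rewrite sr !ev_cat sr sw; split=> //.
  by move: r1; rewrite mulrBr; lra.
by move: r2; rewrite mulrBr; lra.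
Qed.

(** * Lower bounds for sums over positions of disagreement *)

Lemma sum_nat_ge_term (R : realFieldType) (f : nat -> R) a b k :
  (forall k, 0 <= f k) -> (a <= k < b)%N -> f k <= \sum_(a <= j < b) f j.
Proof.
move=> f0 /andP[ak kb].
rewrite (big_cat_nat (n := k)) //=; last exact: ltnW.
by rewrite [X in _ + X]big_ltn // addrCA lerDl addr_ge0 // sumr_ge0.
Qed.

Lemma sum_windows (R : realFieldType) (f : nat -> R) h c m :
  (forall k, 0 <= f k) ->
  (forall j, (j < m)%N -> exists k1 k2,
     [/\ (j * (2 * h) <= k1 < j * (2 * h) + h)%N,
         (j * (2 * h) + h <= k2 < j.+1 * (2 * h))%N & c <= f k1 + f k2]) ->
  m%:R * c <= \sum_(0 <= k < m * (2 * h)) f k.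
Proof.
move=> f0; elim: m => [|m IH] H.
  by rewrite mul0r sumr_ge0.
rewrite (big_cat_nat (n := (m * (2 * h))%N)) //=; last by rewrite leq_mul2r leqnSn orbT.
rewrite -natr1 mulrDl mul1r lerD //; first by apply: IH => j jm; apply: H; apply: ltnW.
have [k1 [k2 [h1 h2 ck]]] := H m (ltnSn m).
have e : (m * (2 * h) + h <= m.+1 * (2 * h))%N by lia.
rewrite (big_cat_nat (n := (m * (2 * h) + h)%N)) //=; last by lia.
apply: le_trans ck _; apply: lerD; exact: sum_nat_ge_term.
Qed.

Lemma uniform_Im_bound (R : realType) (alpha : R[i]) n :
  (forall j, (0 < j)%N -> cIm (alpha ^+ j) != 0) ->
  exists2 c, 0 < c & forall j, (0 < j < n)%N -> c <= `|cIm (alpha ^+ j)|.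
Proof.
move=> H; elim: n => [|n [c c0 hc]]; first by exists 1 => // j; lia.
case: n hc => [|n] hc; first by exists 1 => // j; lia.
exists (Num.min c `|cIm (alpha ^+ n.+1)|).
  by rewrite lt_min c0 normr_gt0 H.
move=> j /andP[j0 jn]; rewrite ge_min; have [jn'|jn'] := ltnP j n.+1.
  by rewrite hc ?j0.
by have -> : j = n.+1 by [lia]; rewrite lexx orbT.
Qed.

(** Since [cIm u * cIm beta = cRe u * cRe beta - cRe (u * beta)], a rotation that is far from real
    cannot take one nearly imaginary unit number to another. *)
Lemma rotated_real_parts (R : realType) (u beta : R[i]) c :
  nrm u = 1 -> nrm beta = 1 -> 0 < c -> c <= `|cIm beta| ->
  Num.min (2^-1) (c / 2) <= `|cRe u| + `|cRe (u * beta)|.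
Proof.
move=> u1 b1 c0 cb; rewrite ge_min.
have [h|h] := leP 2^-1 `|cRe u|.
  by rewrite (le_trans h) // lerDl.
apply/orP; right.
have uu : cRe u ^+ 2 + cIm u ^+ 2 = 1 by rewrite -nrm_sqr u1 expr1n.
have hI : 2^-1 <= `|cIm u|.
  have e1 := real_normK (num_real (cRe u)); have e2 := real_normK (num_real (cIm u)).
  have n1 := normr_ge0 (cRe u); have n2 := normr_ge0 (cIm u).
  rewrite -e1 -e2 in uu; move: uu h n1 n2; move: `|cRe u| `|cIm u| => x y.
  by rewrite leNgt => uu h n1 n2; apply/negP => h2; nra.
have hM : `|cIm u| * `|cIm beta| <= `|cRe u| + `|cRe (u * beta)|.
  rewrite -normrM; have -> : cIm u * cIm beta = cRe u * cRe beta - cRe (u * beta).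
    by rewrite cReM; ring.
  apply: le_trans (ler_normB _ _) _; rewrite lerD2r normrM ler_piMr //.
  by rewrite -b1 abs_cRe_le_nrm.
apply: le_trans hM; have : c / 2 = 2^-1 * c by rewrite mulrC.
by move=> ->; apply: ler_pM => //; lra.
Qed.

(** * The maximum principle at a conjugate *)

(** With [k] the length of the heads, these differ by at most [q ^+ k / (q - 1)], while the
    difference of the tails is scaled by [q ^+ (k + size c)]. A long common middle thus brings the
    tails closer than [delta], and separation makes them equal. *)
Lemma agreement_vanishes (R : realFieldType) (q delta : R) tw tr c a b :
  1 < q -> (forall u v, `|ev q u - ev q v| < delta -> ev q u = ev q v) ->
  size tw = size tr -> 1 + (q - 1)^-1 < delta * q ^+ size c ->
  `|ev q (tw ++ c ++ a) - ev q (tr ++ c ++ b)| <= 1 -> ev q a = ev q b.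
Proof.
move=> q1 sep st hc D; apply: sep.
have q0 : 0 < q by lra.
have i0 : 0 < (q - 1)^-1 by rewrite invr_gt0; lra.
set k := size tw; have qk : 1 <= q ^+ k by rewrite exprn_ege1 // ltW.
have qk0 : 0 < q ^+ k by rewrite exprn_gt0.
have qc0 : 0 < q ^+ size c by rewrite exprn_gt0.
have bt x : size x = k -> 0 <= ev q x <= (q ^+ k - 1) * (q - 1)^-1.
  move=> sx; rewrite ev_ge0 ?(ltW q0) //= -ev_onesE // -sx.
  exact: ev_le_ones (ltW q0).
have /andP[w1 w2] := bt tw erefl; have /andP[r1 r2] := bt tr (esym st).
have E : ev q (tw ++ c ++ a) - ev q (tr ++ c ++ b) =
   (ev q tw - ev q tr) + q ^+ k * (q ^+ size c * (ev q a - ev q b)).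
  by rewrite !ev_cat -st -/k; ring.
rewrite {}E in D; rewrite -(ltr_pM2l qc0) -{1}(ger0_norm (ltW qc0)) -normrM.
rewrite [_ * delta]mulrC; apply: le_lt_trans hc.
rewrite -(ler_pM2l qk0) -{1}(ger0_norm (ltW qk0)) -normrM.
move: D w1 w2 r1 r2; move: (ev q tw) (ev q tr) (q ^+ k * (_ * (_ - _))) => x y z D w1 w2 r1 r2.
have xy : `|x - y| <= q ^+ k * (q - 1)^-1.
  rewrite mulrBl mul1r in w2 r2; rewrite ler_norml; apply/andP; split; lra.
have := ler_normB (x - y + z) (x - y).
have -> : x - y + z - (x - y) = z by ring.
by rewrite mulrDr mulr1; lra.
Qed.

Section MaximumPrinciple.
Variables (R : realType) (q delta B : R) (alpha : R[i]).
Hypotheses (q_gt1 : 1 < q) (q_lt2 : q < 2) (delta_gt0 : 0 < delta).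
Hypothesis sep : separated q delta.
Hypothesis transfer : forall s t, ev q s = ev q t -> ev alpha s = ev alpha t.
Hypothesis bounded : forall u v, 0 <= ev q u - ev q v -> ev q u - ev q v <= 1 ->
  nrm (ev alpha u - ev alpha v) <= B.

Variables (s : nat) (u0 v0 : seq bool).
Hypothesis s_gt0 : (0 < s)%N.
Let y := ev q u0 - ev q v0.
Hypotheses (y_ge0 : 0 <= y) (y_le : q ^+ s * y <= 1).
Let z : R[i] := alpha ^+ s * (ev alpha u0 - ev alpha v0) - (q ^+ s * y)%:C%C.

Let q_gt0 : 0 < q. Proof. exact: lt_trans q_gt1. Qed.

(** As [kap] makes [l i] vanish, the word of positive positions has digit 0 at [i], which is the
    room the competitor needs. The left side of the energy identity is then at most [B] plus the
    absolute value of [kap]. *)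
Lemma energy_competitor theta i (kap := cRe (theta * alpha ^+ i) / q ^+ i)
    (l := fun k => cRe (theta * alpha ^+ k) - kap * q ^+ k) : nrm theta = 1 ->
  exists w r, [/\ size w = (i + s)%N, size r = (i + s)%N,
    forall k, (k < i + s)%N -> nth false w k = (0 < l k),
    0 <= ev q (w ++ u0) - ev q (r ++ v0) <= 1 &
    \sum_(k < i + s) `|l k| * (nth false w k != nth false r k)%:R
      + cRe (theta * alpha ^+ i * z) <= B + nrm alpha ^+ i / q ^+ i].
Proof.
move=> th1; pose w := mkseq (fun k => 0 < l k) (i + s).
have q0 : q != 0 by rewrite gt_eqF.
have sw : size w = (i + s)%N by rewrite size_mkseq.
have wE k : (k < i + s)%N -> nth false w k = (0 < l k) by move=> ks; rewrite nth_mkseq.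
have iis : (i < i + s)%N by rewrite -addn1 leq_add2l.
have wi : nth false w i = false.
  by rewrite wE // /l /kap divfK ?subrr ?ltxx // expf_neq0.
have [r [sr r1 r2]] := competitor q_gt1 (ltW q_lt2) sw iis wi y_ge0 y_le.
exists w, r; split=> //; first by rewrite r1.
rewrite -(@energy_identity R q alpha theta i s u0 v0 w r l kap y z q0) //.
have kapB : `|kap| <= nrm alpha ^+ i / q ^+ i.
  rewrite /kap normrM [`|(q ^+ i)^-1|]ger0_norm ?invr_ge0 ?exprn_ge0 ?(ltW q_gt0) //.
  apply: ler_wpM2r; first by rewrite invr_ge0 exprn_ge0 // ltW.
  by rewrite -nrmX -[nrm (alpha ^+ i)]mul1r -th1 -nrmM abs_cRe_le_nrm.
apply: lerD.
  apply: le_trans (cRe_le_nrm _) _; rewrite nrmM th1 mul1r; exact: bounded.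
apply: le_trans kapB; apply: le_trans (ler_norm _) _; rewrite normrN normrM.
by rewrite ler_piMr // ger0_norm.
Qed.

Lemma expanding_max_principle : 1 < nrm alpha -> z = 0.
Proof.
move=> a1; apply/eqP; apply: contraT => z0.
have n0 := nrm_gt0 z0.
(* The inequality to refute is [nrm alpha ^+ i * nrm z <= B + nrm alpha ^+ i / q ^+ i]; for large
   [i] each term on the right is less than half of the left side. *)
have [i1 h1] := @expr_unbounded R (nrm alpha) (2 * B / nrm z) a1.
have [i2 h2] := @expr_unbounded R q (2 / nrm z) q_gt1.
pose i := maxn i1 i2.
have {}h1 := h1 i (leq_maxl _ _); have {}h2 := h2 i (leq_maxr _ _).
have a0 : 0 < nrm alpha ^+ i by rewrite exprn_gt0 // (lt_trans ltr01).
have x0 : alpha ^+ i * z != 0.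
  by rewrite -nrm_eq0 nrmM nrmX mulf_neq0 ?gt_eqF.
have [th [th1 thE]] := unit_direction x0.
have [w [r [_ _ _ _]]] := energy_competitor i th1.
rewrite -mulrA thE nrmM nrmX; set S := \sum_(k < _) _ => hS.
have S0 : 0 <= S by apply: sumr_ge0 => k _; rewrite mulr_ge0.
have qi0 : 0 < q ^+ i by rewrite exprn_gt0.
rewrite ltr_pdivrMr // in h1; rewrite ltr_pdivrMr // in h2.
have : nrm alpha ^+ i / q ^+ i < nrm alpha ^+ i * nrm z / 2.
  by rewrite -mulrA ltr_pM2l // ltr_pdivlMr // mulrC ltr_pdivrMr // mulrC.
by move: h1 hS S0; move: (nrm alpha ^+ i / q ^+ i) (nrm alpha ^+ i) (nrm z) => A1 A2 A3 *; lra.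
Qed.

(** Copying the head of [w] onto [r] gives equal values at [q], hence at [alpha]. The left side of
    the energy identity is then 0, while its sum is nonnegative. *)
Lemma splice_contradiction theta i w r k' :
  let kap := cRe (theta * alpha ^+ i) / q ^+ i in
  let l := fun k => cRe (theta * alpha ^+ k) - kap * q ^+ k in
  size w = (i + s)%N -> size r = (i + s)%N ->
  (forall k, (k < i + s)%N -> nth false w k = (0 < l k)) ->
  (k' <= i)%N ->
  ev q (drop k' w ++ u0) = ev q (drop k' r ++ v0) ->
  cRe (theta * alpha ^+ i * z) <= 0.
Proof.
move=> kap l sw sr wE ki e.
have q0 : q != 0 by rewrite gt_eqF.
have kK : (k' <= i + s)%N by rewrite (leq_trans ki) // leq_addr.
pose r' := take k' w ++ drop k' r.
have sr' : size r' = (i + s)%N.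
  by rewrite size_cat size_takel ?sw // size_drop sr subnKC.
have e1 : ev q (w ++ u0) = ev q (r' ++ v0).
  rewrite -(cat_take_drop k' w) /r' -!catA !(ev_cat _ (take k' w)).
  by rewrite e.
have e2 := transfer e1.
have := @energy_identity R q alpha theta i s u0 v0 w r' l kap y z q0.
rewrite e1 e2 !subrr !mulr0 subr0 => h.
have {h} := h erefl (fun=> erefl) erefl erefl sw sr' wE.
set S := \sum_(k < _) _ => h; rewrite (_ : cRe _ = - S); last first.
  by apply/eqP; rewrite -addr_eq0 addrC -h.
by rewrite oppr_le0 sumr_ge0 // => k _; rewrite mulr_ge0.
Qed.

Lemma rotating_max_principle : nrm alpha = 1 ->
  (forall j, (0 < j)%N -> cIm (alpha ^+ j) != 0) -> z = 0.
Proof.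
move=> a1 aj; apply/eqP; apply: contraT => z0.
have q1 := q_gt1; have q0 := q_gt0; have d0 := delta_gt0.
have B0 : 0 <= B.
  apply: le_trans (nrm_ge0 (ev alpha [::] - ev alpha [::])) _.
  by apply: bounded; rewrite subrr.
(* [h] is a length of agreement that suffices for [agreement_vanishes]. *)
have [h /(_ h (leqnn h))] := @expr_unbounded R q ((1 + (q - 1)^-1) / delta) q_gt1.
rewrite ltr_pdivrMr // [_ * delta]mulrC => hh.
have [c c0 hc] := uniform_Im_bound (2 * h) aj.
set c' := Num.min (2^-1) (c / 2).
have c'0 : 0 < c' by rewrite /c' lt_min; apply/andP; split; lra.
(* The last [g] positions before [i] are set aside: on the earlier ones [kap * q ^+ k] is at most
   [c' / 4] in absolute value, so two disagreements carry at least [c' - 2 * (c' / 4)]. Then [m]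
   such pairs exceed the available energy [B + 1]. *)
have [g /(_ g (leqnn g)) hg] := @expr_unbounded R q (4 / c') q_gt1.
have [m hm] : exists m, B + 1 < m%:R * (c' / 2).
  exists (Num.bound ((B + 1) / (c' / 2))); rewrite -ltr_pdivrMr; last by rewrite divr_gt0.
  by apply: archi_boundP; apply: divr_ge0; lra.
have [i iE] : exists i, i = (m * (2 * h) + g)%N by eexists.
have x0 : alpha ^+ i * z != 0.
  by rewrite -nrm_eq0 nrmM nrmX a1 expr1n mul1r nrm_eq0.
have [th [th1]] := unit_direction x0; rewrite mulrA => thE.
have n0 := nrm_gt0 x0.
have [w [r [sw sr wE D01 hS]]] := energy_competitor i th1.
move: wE hS; set kap := cRe _ / _ => wE hS.
set l := fun k => cRe (th * alpha ^+ k) - kap * q ^+ k.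
(* Agreement on [h] consecutive positions would make the tails equal, and splicing would make the
   gain nonpositive, whereas [th] makes it positive. *)
have claim k0 : (k0 + h <= i)%N ->
    exists2 k, (k0 <= k < k0 + h)%N & nth false w k != nth false r k.
  move=> kh; apply: contrapT => nex.
  have km : (k0 + h <= i + s)%N by rewrite (leq_trans kh) // leq_addr.
  have khK : (h <= i + s - k0)%N by clear -km; lia.
  have sth x : size x = (i + s)%N -> size (take h (drop k0 x)) = h.
    by move=> sx; rewrite size_takel // size_drop sx.
  have seg : take h (drop k0 w) = take h (drop k0 r).
    apply: (@eq_from_nth _ false); first by rewrite !sth.
    move=> k; rewrite sth // => kh'; rewrite !nth_take // !nth_drop.
    apply/eqP/negP => /negP ne; apply: nex; exists (k0 + k)%N => //.
    by rewrite leq_addr ltn_add2l.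
  have spl (x t : seq bool) :
      take k0 x ++ take h (drop k0 x) ++ drop (k0 + h) x ++ t = x ++ t.
    by rewrite addnC -drop_drop [take h _ ++ _]catA cat_take_drop catA cat_take_drop.
  have stk x : size x = (i + s)%N -> size (take k0 x) = k0.
    by move=> sx; rewrite size_takel // sx; apply: leq_trans km; apply: leq_addr.
  suff : ev q (drop (k0 + h) w ++ u0) = ev q (drop (k0 + h) r ++ v0).
    by move/(splice_contradiction sw sr wE kh); rewrite thE leNgt n0.
  apply: (agreement_vanishes (tw := take k0 w) (tr := take k0 r)
    (c := take h (drop k0 w)) q_gt1 sep); first by rewrite !stk.
    by rewrite sth.
  rewrite {2}seg !spl ger0_norm; by case/andP: D01.
pose f k := `|l k| * (nth false w k != nth false r k)%:R.
have f0 k : 0 <= f k by rewrite mulr_ge0.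
have kapB k : (k < m * (2 * h))%N -> `|kap * q ^+ k| <= c' / 4.
  move=> km; rewrite normrM [`|q ^+ k|]ger0_norm ?exprn_ge0 ?(ltW q0) //.
  have kap1 : `|kap| <= (q ^+ i)^-1.
    rewrite /kap normrM [`|(q ^+ i)^-1|]ger0_norm ?invr_ge0 ?exprn_ge0 ?(ltW q0) //.
    apply: ler_piMl; first by rewrite invr_ge0 exprn_ge0 // ltW.
    by apply: le_trans (abs_cRe_le_nrm _) _; rewrite nrmM nrmX a1 th1 expr1n mulr1.
  have qk : 0 < q ^+ k by rewrite exprn_gt0.
  apply: le_trans (ler_wpM2r (ltW qk) kap1) _.
  have -> : i = (k + (i - k - g) + g)%N by clear -iE km; lia.
  rewrite !exprD; have qq : 1 <= q ^+ (i - k - g) by rewrite exprn_ege1 // ltW.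
  have qg : 0 < q ^+ g by rewrite exprn_gt0.
  rewrite mulrC ler_pdivrMr ?mulr_gt0 //; last by rewrite (lt_le_trans ltr01).
  rewrite ltr_pdivrMr // in hg.
  have e1 : q ^+ k <= q ^+ k * q ^+ (i - k - g) by rewrite ler_peMr // ltW.
  apply: le_trans e1 _; set X := _ * _; have X0 : 0 < X by rewrite mulr_gt0 // (lt_le_trans ltr01).
  by rewrite [_ * q ^+ g]mulrC mulrA; apply: ler_peMl; [exact: ltW|lra].
have win : m%:R * (c' / 2) <= \sum_(0 <= k < m * (2 * h)) f k.
  apply: sum_windows => // j jm.
  have jm' : (j.+1 * (2 * h) <= m * (2 * h))%N by rewrite leq_mul2r jm orbT.
  have jS : (j.+1 * (2 * h) = j * (2 * h) + h + h)%N by clear; lia.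
  have [|k1 hk1 d1] := claim (j * (2 * h))%N; first by clear -iE jm' jS; lia.
  have [|k2 hk2 d2] := claim (j * (2 * h) + h)%N; first by clear -iE jm' jS; lia.
  exists k1, k2; rewrite hk1 jS hk2; split=> //.
  have k1m : (k1 < m * (2 * h))%N by clear -hk1 jm' jS; lia.
  have k2m : (k2 < m * (2 * h))%N by clear -hk2 jm' jS; lia.
  rewrite /f d1 d2 !mulr1 /l.
  have k12 : (k1 < k2)%N by clear -hk1 hk2; lia.
  have -> : alpha ^+ k2 = alpha ^+ k1 * alpha ^+ (k2 - k1) by rewrite -exprD subnKC // ltnW.
  have u1 : nrm (th * alpha ^+ k1) = 1 by rewrite nrmM nrmX a1 expr1n mulr1.
  have b1 : nrm (alpha ^+ (k2 - k1)) = 1 by rewrite nrmX a1 expr1n.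
  have cb : c <= `|cIm (alpha ^+ (k2 - k1))| by apply: hc; clear -hk1 hk2; lia.
  have := rotated_real_parts u1 b1 c0 cb; rewrite -/c' -mulrA.
  have := kapB _ k1m; have := kapB _ k2m.
  move: (kap * _) (kap * _) (cRe _) (cRe _) => K2 K1 x1 x2.
  have := lerB_dist x1 K1; have := lerB_dist x2 K2.
  by move=> *; lra.
have : \sum_(0 <= k < m * (2 * h)) f k <= \sum_(k < i + s) f k.
  rewrite -(big_mkord xpredT f) (big_cat_nat (n := (m * (2 * h))%N) (p := (i + s)%N)) //=; last by clear -iE; lia.
  by rewrite lerDl sumr_ge0.
have q_i : 1 / q ^+ i <= 1.
  by rewrite ler_pdivrMr ?exprn_gt0 // mul1r exprn_ege1 // ltW.
move: hS; rewrite thE a1 expr1n -/l -/(f _).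
rewrite -[X in X + _ <= _]/(\sum_(k < i + s) f k).
by move: (\sum_(_ < _) _) => S; lra.
Qed.
End MaximumPrinciple.

(** * Non-Pisot bases have small differences *)

Lemma horner_word (A : comNzRingType) (x : A) s : (ev 'X s).[x] = ev x s.
Proof. elim: s => [|b s IH] /=; first by rewrite horner0.
by rewrite hornerD hornerM hornerX IH -polyC_natr hornerC. Qed.

Lemma map_word (A B : comNzRingType) (f : {rmorphism A -> B}) s :
  map_poly f (ev 'X s) = ev 'X s.
Proof.
by elim: s => [|b s IH] /=; rewrite ?rmorph0 // rmorphD rmorphM /= map_polyX IH rmorph_nat.
Qed.

Lemma size_word (A : comNzRingType) s : (size (ev ('X : {poly A}) s) <= size s)%N.
Proof.
elim: s => [|b s IH] /=; first by rewrite size_poly0.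
rewrite (leq_trans (size_polyD _ _)) // geq_max; apply/andP; split.
  by rewrite -polyC_natr (leq_trans (size_polyC_leq1 _)).
by rewrite mulrC (leq_trans (size_polyMleq _ _)) // size_polyX addn2.
Qed.

Lemma algebraic_integer_of_words (R : realType) (q : R) s t b :
  size s = b -> size t = b -> ev q t = ev q (rcons s true) -> algebraic_integer q.
Proof.
move=> ss st e; exists ('X^b + (ev 'X s - ev 'X t)); split.
  rewrite monicE lead_coefDl ?lead_coefXn // size_polyXn ltnS.
  rewrite (leq_trans (size_polyD _ _)) // size_polyN geq_max.
  by rewrite -{1}ss -st !size_word.
rewrite /root rmorphD rmorphB /= map_polyXn !map_word hornerD hornerXn hornerD hornerN !horner_word e.
by rewrite ev_rcons ss mulr1 opprD addNKr subrr.
Qed.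

Lemma monic_scale_rat (p : {poly rat}) : p != 0 ->
  (lead_coef p)^-1 *: p \is monic.
Proof.
by move=> p0; rewrite monicE lead_coefZ mulVf // lead_coef_eq0.
Qed.

Lemma minimal_polynomial_exists (R : realType) (x : R) :
  algebraic_integer x -> exists p, minimal_polynomial x p.
Proof.
move=> [g [gm gr]].
pose P n := `[< exists p : {poly rat}, [/\ p \is monic, size p = n & root (map_poly ratr p) x] >].
have exP : exists n, P n.
  exists (size (map_poly intr g : {poly rat})); apply/asboolP.
  exists (map_poly intr g); split=> //; first exact: monic_map.
  rewrite -map_poly_comp (@eq_map_poly _ _ _ intr) // => z.
  by rewrite /= ratr_int.
case: (ex_minnP exP) => n /asboolP[p [pm sp pr]] nmin; exists p.
have nmin' (d : {poly rat}) : d != 0 -> root (map_poly ratr d) x -> (size p <= size d)%N.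
  move=> d0 dr; rewrite sp; apply: nmin; apply/asboolP.
  exists ((lead_coef d)^-1 *: d); split; first exact: monic_scale_rat.
    by rewrite size_scale // invr_eq0 lead_coef_eq0.
  by rewrite map_polyZ /= rootZ // fmorph_eq0 invr_eq0 lead_coef_eq0.
have p0 : p != 0 by rewrite monic_neq0.
split=> //; split=> //; split.
  rewrite ltnNge; apply/negP => /size1_polyC pC.
  move: pr; rewrite pC map_polyC rootC fmorph_eq0 => /eqP c0.
  by move: p0; rewrite pC c0 eqxx.
move=> d d1 /dvdpP[e pe].
have e0 : e != 0 by apply: contraNneq p0 => e0; rewrite pe e0 mul0r.
have d0 : d != 0 by apply: contraNneq p0 => d0; rewrite pe d0 mulr0.
have dp : d %| p by rewrite pe dvdp_mull.
have : root (map_poly ratr e) x || root (map_poly ratr d) x by rewrite -rootM -rmorphM /= -pe.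
case/orP => [er|dr]; last first.
  by rewrite -dvdp_size_eqp // eqn_leq dvdp_leq //= nmin'.
have := nmin' _ e0 er; rewrite pe size_mul // => h.
have sd : (0 < size d)%N by rewrite size_poly_gt0.
by move: d1 h sd; case: (size d) (size e) => [|[|m]] k //=; rewrite addnS /= addnS ltnNge leq_addr.
Qed.

Lemma irreducible_dvd (F : numFieldType) (p g : {poly rat}) (x : F) :
  irreducible_poly p -> root (map_poly ratr p) x -> root (map_poly ratr g) x -> p %| g.
Proof.
move=> ip px gx; apply: contraT => npg.
have cpg : coprimep p g.
  by rewrite irreducible_poly_coprime.
have := cpg; rewrite -(coprimep_map (ratr : {rmorphism rat -> F})) => /coprimep_root /(_ px).
by rewrite -/(root _ _) gx.
Qed.

Lemma dvd_root (F : numFieldType) (p g : {poly rat}) (x : F) :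
  p %| g -> root (map_poly ratr p) x -> root (map_poly ratr g) x.
Proof. by move=> pg; apply: root_dvdp; rewrite dvdp_map. Qed.

(** * Geometric words and multinacci numbers *)

(** The values differ by [x ^+ m - (1 + x + ... + x ^+ (m - 1))], which vanishes at the multinacci
    number of order [m]. *)
Definition geom_word m := (nseq m false ++ [:: true], nseq m true).

Lemma ev_geom_word (A : comNzRingType) (x : A) m :
  (x - 1) * (ev x (geom_word m).1 - ev x (geom_word m).2) = 1 - (2 - x) * x ^+ m.
Proof.
rewrite mulrBr ev_nseq1 ev_cat ev_nseq0 size_nseq /=; ring.
Qed.

Lemma ev_geom_wordS (A : comNzRingType) (x : A) m :
  ev x (geom_word m.+1).1 - ev x (geom_word m.+1).2 =
  x * (ev x (geom_word m).1 - ev x (geom_word m).2) - 1.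
Proof. by rewrite /=; ring. Qed.

(** For the least [m] with [q * D m <= 1], positivity of [D m = q * D (m - 1) - 1] is the failure of
    the inequality at [m - 1]. Such an [m] exists because [D m] is negative once [(2 - q) * q ^+ m]
    exceeds 1. *)
Lemma geom_word_small (R : realType) (q : R) : 1 < q -> q < 2 -> exists m,
  let D m := ev q (geom_word m).1 - ev q (geom_word m).2 in
  [/\ (0 < m)%N, 0 < D m & q * D m <= 1].
Proof.
move=> q1 q2; pose D m := ev q (geom_word m).1 - ev q (geom_word m).2.
have exP : exists m, q * D m <= 1.
  have [b /(_ b (leqnn b))] := @expr_unbounded R q (2 - q)^-1 q1.
  rewrite -div1r ltr_pdivrMr ?subr_gt0 // => hb; exists b.
  have := ev_geom_word q b; rewrite -/(D b); move: (D b) => x hx.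
  have : x < 0 by rewrite -(pmulr_rlt0 _ (_ : 0 < q - 1)) ?subr_gt0 // hx; lra.
  by nra.
case: (ex_minnP exP) => m hm mmin; exists m; rewrite /= -/(D m).
case: m hm mmin => [|m] hm mmin.
  by move: hm; rewrite /D /=; lra.
split=> //; rewrite /D ev_geom_wordS -/(D m).
have : ~~ (q * D m <= 1) by apply/negP => /mmin; rewrite ltnn.
by rewrite -ltNge subr_gt0.
Qed.

Lemma sum_powers_mono (R : realFieldType) (M : nat) (x y : R) : 0 <= x -> x < y ->
  (0 < M)%N -> \sum_(k < M) x ^+ k.+1 < \sum_(k < M) y ^+ k.+1.
Proof.
move=> x0 xy M0; case: M M0 => // M _; rewrite !big_ord_recl /= !expr1.
apply: ltr_leD => //; apply: ler_sum => k _.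
by apply: lerXn2r; rewrite ?nnegrE ?(ltW xy) //; apply: le_trans x0 (ltW xy).
Qed.

(* Multinacci numbers are Pisot: a root [beta] of [x + x^2 + ... + x^M = 1] in the
   closed unit disc is the real one. *)
Lemma multinacci_root (R : realType) (M : nat) (b : R) (beta : R[i]) :
  (1 < M)%N -> 0 < b -> nrm beta <= 1 ->
  \sum_(k < M) b ^+ k.+1 = 1 -> \sum_(k < M) beta ^+ k.+1 = 1 -> beta = b%:C%C.
Proof.
move=> M1 b0 x1 Tb Tbeta; set x := nrm beta.
have x0 : 0 <= x by exact: nrm_ge0.
have geo (A : comNzRingType) (t : A) : (1 - t) * \sum_(k < M) t ^+ k.+1 = t - t ^+ M.+1.
  rewrite (eq_bigr (fun k : 'I_M => t * t ^+ k)) => [|k _]; last by rewrite exprS.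
  by rewrite -mulr_sumr mulrCA -opprB mulNr -subrX1 exprS; ring.
have two_beta : 2 * beta = 1 + beta ^+ M.+1.
  have := geo _ beta; rewrite Tbeta mulr1 => h.
  have -> : beta ^+ M.+1 = beta - (1 - beta) by rewrite h; ring.
  by ring.
have real_pos : cRe beta = x -> beta = x%:C%C.
  move=> re; have := nrm_sqr beta; rewrite -/x re => /eqP.
  rewrite -subr_eq0 opprD addrA subrr sub0r oppr_eq0 sqrf_eq0 => /eqP im.
  by move: re im; case: (beta) => r i /= -> ->.
have ReT : 1 = \sum_(k < M) cRe (beta ^+ k.+1) by rewrite -cRe_sum Tbeta.
have Re_le k : cRe (beta ^+ k.+1) <= x ^+ k.+1 by rewrite /x -nrmX cRe_le_nrm.
have Tx1 : 1 <= \sum_(k < M) x ^+ k.+1 by rewrite {1}ReT; apply: ler_sum => k _.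
(* On the unit circle [nrm (2 * beta - 1) = 1] leaves only [beta = 1], where the sum is [M], not
   1. *)
move: x1; rewrite -/x le_eqVlt => /orP[/eqP x1|x1].
  have e1 : nrm beta ^+ 2 = 1 by rewrite -/x x1 expr1n.
  have e2 : nrm (2 * beta - 1) ^+ 2 = 1.
    by rewrite two_beta addrAC subrr add0r nrmX -/x x1 !expr1n.
  have re1 : cRe beta = x.
    move: e1 e2; rewrite !nrm_sqr x1; case: (beta) => r i.
    by rewrite mulr_natl mulr2n /= => h1 h2; nra.
  have b1 : beta = 1 by rewrite real_pos // x1.
  move: Tbeta; rewrite b1 (eq_bigr (fun=> 1)) => [|k _]; last by rewrite expr1n.
  rewrite sumr_const card_ord => /eqP; rewrite -[X in _ == X](mulr1n 1) eqr_nat.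
  by case: M M1 {Tb geo two_beta ReT Tx1 e2} => [|[|M]].
(* The triangle inequality for [2 * beta = 1 + beta ^+ M.+1] bounds the sum at [x] by 1 from above,
   and [Tx1] from below. Equality gives [x = b] by monotonicity and forces each power of [beta] to
   have real part equal to its modulus. *)
have Tx : \sum_(k < M) x ^+ k.+1 = 1.
  apply/eqP; rewrite eq_le Tx1 andbT.
  have p1 : 0 < 1 - x by rewrite subr_gt0.
  rewrite -(ler_pM2l p1) geo mulr1.
  have : nrm (2 * beta) <= 1 + x ^+ M.+1.
    by rewrite two_beta /x -nrmX -[X in _ <= X + _](nrm1 R) nrmD.
  have -> : nrm (2 * beta) = 2 * x.
    have -> : (2 : R[i]) = (2 : R)%:C%C by rewrite rmorph_nat.
    by rewrite nrmM nrm_real ger0_norm.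
  by lra.
have M0 : (0 < M)%N by exact: ltnW.
have xb : x = b.
  apply/eqP; rewrite eq_le !leNgt; apply/andP; split; apply/negP => h.
    by have := sum_powers_mono (ltW b0) h M0; rewrite Tb Tx ltxx.
  by have := sum_powers_mono x0 h M0; rewrite Tb Tx ltxx.
rewrite -xb; apply: real_pos.
have S0 : \sum_(k < M) (x ^+ k.+1 - cRe (beta ^+ k.+1)) = 0 by rewrite sumrB Tx -ReT subrr.
have := psumr_eq0P _ S0 => /(_ _ (Ordinal M0) isT) h.
by apply/esym/eqP; rewrite -subr_eq0 -{1}[x]expr1 -{1}[beta]expr1 h // => k _; rewrite subr_ge0.
Qed.

Lemma sum_inverse_powers (A : fieldType) (x : A) m : x != 0 ->
  ev x (geom_word m).1 - ev x (geom_word m).2 = 0 ->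
  \sum_(k < m) x^-1 ^+ k.+1 = 1.
Proof.
move=> x0; rewrite /= ev_cat ev_nseq0 size_nseq /= mulr0 addr0 add0r mulr1 => /eqP.
rewrite subr_eq0 => /eqP E.
have H : x ^+ m * \sum_(k < m) x^-1 ^+ k.+1 = ev x (nseq m true).
  elim: m {E} => [|m IH]; first by rewrite big_ord0 mulr0.
  rewrite big_ord_recr /= mulrDr exprS -mulrA IH -exprS -exprMn mulfV //.
  by rewrite expr1n addrC.
by apply: (mulfI (expf_neq0 m x0)); rewrite H mulr1 -E.
Qed.

(* The second hypothesis is applied to a difference [y <= 1 / q] with [s = 1], then to [y]
   with [s = 2] or to [1 - q * y] with [s = 1]; only the case [q * y = 1], in which [q] is a
   multinacci number, needs another argument. *)
Lemma conjugate_trivial (R : realType) (q : R) (alpha : R[i]) :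
  1 < q -> q < 2 -> 1 <= nrm alpha ->
  (forall s t, ev q s = ev q t -> ev alpha s = ev alpha t) ->
  (forall s u v, (0 < s)%N -> 0 <= ev q u - ev q v ->
     q ^+ s * (ev q u - ev q v) <= 1 ->
     alpha ^+ s * (ev alpha u - ev alpha v) = (q ^+ s * (ev q u - ev q v))%:C%C) ->
  alpha = q%:C%C.
Proof.
move=> q1 q2 a1 H MP; have q0 : 0 < q by lra.
have alpha0 : alpha != 0 by rewrite -nrm_eq0 gt_eqF // (lt_le_trans ltr01).
have toC (x y : R) : (x * y)%:C%C = x%:C%C * y%:C%C :> R[i] by rewrite rmorphM.
have cancel (y : R) : y != 0 -> alpha * y%:C%C = (q * y)%:C%C -> alpha = q%:C%C.
  move=> y0; rewrite toC; apply: mulIf.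
  by rewrite -nrm_eq0 nrm_real normr_eq0.
have [m [m0 D0 D1]] := geom_word_small q1 q2.
have MP1 u v : 0 <= ev q u - ev q v -> q * (ev q u - ev q v) <= 1 ->
    alpha * (ev alpha u - ev alpha v) = (q * (ev q u - ev q v))%:C%C.
  by move=> h1 h2; have := MP 1%N u v isT h1; rewrite !expr1; apply.
have e1 := MP1 _ _ (ltW D0) D1.
move: e1; set y := ev q _ - ev q _ in D0 D1 *; set sy := ev alpha _ - _ => e1.
have [h2|h2] := leP (q ^+ 2 * y) 1.
  apply: (cancel (q * y)); first by rewrite mulf_neq0 // gt_eqF.
  have := MP 2%N _ _ isT (ltW D0) h2; rewrite -/y -/sy => e2.
  by rewrite -e1 mulrA -expr2 e2 expr2 mulrA.
have e3 : ev alpha (geom_word m.+1).1 - ev alpha (geom_word m.+1).2 = (q * y - 1)%:C%C.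
  by rewrite ev_geom_wordS -/sy e1 rmorphB.
have e4 : ev q (geom_word m.+1).1 - ev q (geom_word m.+1).2 = q * y - 1.
  by rewrite ev_geom_wordS.
have [y1|y1] := eqVneq (q * y) 1.
  have qV : nrm alpha^-1 <= 1.
    have := nrmM alpha alpha^-1; rewrite divff // nrm1 => h.
    by have := nrm_ge0 alpha^-1; nra.
  have sq : \sum_(k < m.+1) q^-1 ^+ k.+1 = 1.
    by apply: sum_inverse_powers; rewrite ?gt_eqF // e4 y1 subrr.
  have sa : \sum_(k < m.+1) alpha^-1 ^+ k.+1 = 1.
    by apply: sum_inverse_powers; rewrite // e3 y1 subrr rmorph0.
  have qi : 0 < q^-1 by rewrite invr_gt0.
  have := multinacci_root (_ : (1 < m.+1)%N) qi qV sq sa => /(_ m0) e5.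
  by rewrite -[alpha]invrK e5 -fmorphV invrK.
(* Here [1 < q ^+ 2 * y], hence [q * (1 - q * y) < q - 1 < 1]; the next pair of geometric words, in
   reverse order, has this difference. *)
apply: (cancel (1 - q * y)); first by rewrite subr_eq0 eq_sym.
have := @MP1 (geom_word m.+1).2 (geom_word m.+1).1.
rewrite -(opprB (ev q _)) -(opprB (ev alpha _)) e3 e4 opprB -rmorphN opprB; apply.
  by rewrite subr_ge0.
by nra.
Qed.

Theorem small_differences (R : realType) (q : R) : 1 < q -> q < 2 -> ~ pisot q ->
  forall eps, 0 < eps -> exists u v, 0 < ev q u - ev q v < eps.
Proof.
move=> q1 q2 npisot eps eps0; apply: contrapT => nex; apply: npisot.
have sep : separated q eps.
  move=> u v; rewrite ltr_norml => /andP[h1 h2]; apply/eqP; apply: contraT => ne.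
  exfalso; apply: nex; move: ne; rewrite neq_lt => /orP[h|h].
    by exists v, u; apply/andP; split; lra.
  by exists u, v; apply/andP; split; lra.
have [b F] := common_extension q1 q2 eps0 sep.
have q0 : 0 < q by lra.
have algq : algebraic_integer q.
  (* These two words differ by 1, so a common extension equates a word of length [b + 1] with top
     digit 1 and a word of length [b]: a monic equation for [q]. *)
  have [||s [t [ss st e]]] := F [:: true] [::]; rewrite /=; [lra|lra|].
  by apply: (algebraic_integer_of_words ss st); rewrite -cats1 -e cats0.
split=> //; split=> //; have [p pmin] := minimal_polynomial_exists algq.
have [_ [pirr pq]] := pmin.
exists p; split=> // z pz zq.
have [z1|z1] := ltP (nrm z) 1; first by rewrite normc_def -nrm_def ltcR.
move/negP: zq => zq; exfalso; apply: zq; apply/eqP.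
have word_root (K : numFieldType) (x : K) s t :
    root (map_poly ratr (ev 'X s - ev 'X t)) x = (ev x s - ev x t == 0).
  by rewrite /root rmorphB /= !map_word hornerD hornerN !horner_word.
have H s t : ev q s = ev q t -> ev z s = ev z t.
  move=> e; apply/eqP; rewrite -subr_eq0 -word_root; apply: dvd_root pz.
  by apply: (irreducible_dvd pirr pq); rewrite word_root e subrr.
apply: (conjugate_trivial q1 q2 z1 H) => s u v s0 y0 y1; apply/eqP; rewrite -subr_eq0.
have bdd := conjugate_bound z1 H F; apply/eqP.
have [z1'|z1'] := ltP 1 (nrm z).
  exact: (expanding_max_principle q1 q2 bdd s0 y0 y1 z1').
have {z1'}z1 : nrm z = 1 by apply/eqP; rewrite eq_le z1 z1'.
apply: (rotating_max_principle q1 q2 eps0 sep H bdd s0 y0 y1 z1) => j j0.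
(* A real power of [z] has modulus 1, so [z] would be a root of unity; then [p] would divide
   ['X^(j + j) - 1], which has no root [q > 1]. *)
apply/eqP => im0.
have zj : z ^+ j = (cRe (z ^+ j))%:C%C by case: (z ^+ j) im0 => r i /= ->.
have zjj : z ^+ (j + j) = 1.
  have := nrm_sqr (z ^+ j); rewrite im0 nrmX z1 !expr1n expr0n addr0 => e.
  by rewrite exprD -expr2 zj -rmorphXn -e.
have unit_root (K : numFieldType) (x : K) :
    root (map_poly ratr ('X^(j + j) - 1)) x = (x ^+ (j + j) == 1).
  by rewrite /root rmorphB /= map_polyXn rmorph1 hornerD hornerN hornerXn hornerC subr_eq0.
have : root (map_poly ratr ('X^(j + j) - 1)) q.
  by apply: dvd_root pq; apply: (irreducible_dvd pirr pz); rewrite unit_root zjj.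
by rewrite unit_root; apply/negP; rewrite gt_eqF // exprn_egt1 // -lt0n addn_gt0 j0.
Qed.

(** * Steering in simplex coordinates *)

Lemma geometric_hits (R : realType) (q x eps : R) : 1 < q -> 0 < x -> x < eps ->
  exists j, eps / q <= q ^+ j * x < eps.
Proof.
move=> q1 x0 xe; have q0 : 0 < q by lra.
have exP : exists j, eps / q <= q ^+ j * x.
  have [b /(_ b (leqnn b)) hb] := @expr_unbounded R q (eps / q / x) q1.
  by exists b; rewrite -ler_pdivrMr // ltW.
case: (ex_minnP exP) => j hj jmin; exists j; rewrite hj /=.
case: j hj jmin => [|j] hj jmin; first by rewrite expr0 mul1r.
have : ~~ (eps / q <= q ^+ j * x) by apply/negP => /jmin; rewrite ltnn.
by rewrite -ltNge ltr_pdivlMr // exprS -mulrA [q * _]mulrC.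
Qed.

(* Each step appends a block with two admissible words whose values differ by about
   [eps], so the covered interval grows by at least [eps / q]. *)
Lemma word_chain (R : realType) (q eps : R) : 1 < q -> 0 < eps ->
  (forall e, 0 < e -> exists u v, 0 < ev q u - ev q v < e) ->
  forall k : nat, exists K a, forall t, a <= t -> t <= a + eps + k%:R * (eps / q) ->
    exists c, [/\ size c = K, ev q c <= t & t <= ev q c + eps].
Proof.
move=> q1 eps0 small; have q0 : 0 < q by lra.
elim=> [|k [K [a IH]]].
  exists 0%N, 0 => t t0 t1; exists [::]; split=> //=; move: t1; rewrite mul0r; lra.
have qK : 0 < q ^+ K by rewrite exprn_gt0.
have [u [v /andP[uv0 uv1]]] := small (eps / q ^+ K) (divr_gt0 eps0 qK).
have [||j /andP[j1 j2]] := @geometric_hits R q (q ^+ K * (ev q u - ev q v)) eps q1.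
- by rewrite mulr_gt0.
- by rewrite mulrC -ltr_pdivlMr.
pose M := maxn (size u) (size v).
pose w b := nseq j false ++ word_pad M (if b then u else v).
have sw b : size (w b) = (j + M)%N.
  by rewrite size_cat size_nseq size_pad // /M; case: b; rewrite ?leq_maxl ?leq_maxr.
have evw b : ev q (w b) = q ^+ j * ev q (if b then u else v).
  by rewrite ev_cat ev_nseq0 size_nseq ev_pad add0r.
have step c b : ev q (c ++ w b) = ev q c + q ^+ size c * ev q (w b) by rewrite ev_cat.
exists (K + (j + M))%N, (a + q ^+ K * ev q (w false)) => t t0 t1.
pose g := q ^+ K * (ev q (w true) - ev q (w false)).
have gE : g = q ^+ j * (q ^+ K * (ev q u - ev q v)) by rewrite /g !evw; ring.
have k0 : 0 <= k%:R * (eps / q) by rewrite mulr_ge0 // divr_ge0 // ltW.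
move: t1; rewrite -natr1 mulrDl mul1r => t1.
rewrite -gE in j1 j2.
have [h|h] := leP t (a + q ^+ K * ev q (w false) + eps + k%:R * (eps / q)).
  have [||c [sc c1 c2]] := IH (t - q ^+ K * ev q (w false)); [lra|lra|].
  by exists (c ++ w false); rewrite size_cat sc sw step sc; split=> //; lra.
have [||c [sc c1 c2]] := IH (t - q ^+ K * ev q (w true)).
- by move: j2; rewrite /g; lra.
- by move: j1; rewrite /g; lra.
by exists (c ++ w true); rewrite size_cat sc sw step sc; split=> //; lra.
Qed.

Lemma steer (R : realType) (Q q eps : R) : 1 < Q -> Q <= 2 -> 0 < q -> 0 < eps ->
  (forall e, 0 < e -> exists u v, 0 < ev Q u - ev Q v < e) ->
  exists K a, forall N, (K <= N)%N -> forall t, a <= t ->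
    t <= a + q * ev Q (nseq N true) ->
    exists c e, [/\ size c = N, size e = N & `|ev Q c + q * ev Q e - t| <= eps].
Proof.
move=> Q1 Q2 q0 eps0 small; have Q0 : 0 < Q by lra.
have e0 : 0 < eps / Q by rewrite divr_gt0.
(* [q * ev Q e] meets a target only up to an error less than [q], so the interval filled by the
   chain must be at least [q] long. *)
pose k := Num.bound (q / (eps / Q)).
have qk : q <= k%:R * (eps / Q).
  rewrite -ler_pdivrMr //; apply/ltW/archi_boundP.
  by rewrite divr_ge0 // ltW.
have [K [a H]] := word_chain Q1 eps0 small k.
exists K, a => N KN t t0 t1.
have [||e [se e1 e2]] := @ev_gap R Q N ((t - a) / q) Q1 Q2.
- by apply: divr_ge0; [lra|exact: ltW].
- by rewrite ler_pdivrMr // mulrC; lra.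
rewrite ler_pdivlMr // in e1; rewrite ltr_pdivrMr // mulrDl mul1r in e2.
have [||c [sc c1 c2]] := H (t - q * ev Q e); [lra|lra|].
exists (word_pad N c), e; rewrite size_pad ?sc // se ev_pad; split=> //.
by rewrite ler_norml; apply/andP; split; lra.
Qed.

(** * Barycentric frames and interleaved digits *)

Section Frame.
Variables (R : realType) (d n : nat) (p : 'I_n.+1 -> 'rV[R]_d).
Variables (i0 : 'I_n.+1) (f : 'I_d -> 'I_n.+1).

Definition frame_mx : 'M[R]_d := \matrix_r (p (f r) - p i0).
(** Barycentric coordinates for the vertices [p i0] and [p (f r)]; the weight of [p i0], which is 1
    minus the sum of the others, is left out, so that [S lam p i0] becomes a pure scaling. *)
Definition coord (x : 'rV[R]_d) : 'rV[R]_d := (x - p i0) *m invmx frame_mx.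

Hypothesis frame_unit : frame_mx \in unitmx.

Lemma coordK x : coord x *m frame_mx + p i0 = x.
Proof. by rewrite mulmxKV // subrK. Qed.

Lemma coord_origin : coord (p i0) = 0.
Proof. by rewrite /coord subrr mul0mx. Qed.

Lemma coord_vertex r : coord (p (f r)) = delta_mx 0 r.
Proof.
rewrite /coord (_ : p (f r) - p i0 = delta_mx 0 r *m frame_mx) ?mulmxK //.
by rewrite -rowE rowK.
Qed.

Lemma coord_comb (t : R) x y :
  coord (t *: x + (1 - t) *: y) = t *: coord x + (1 - t) *: coord y.
Proof.
rewrite /coord !scalemxAl -mulmxDl; congr (_ *m _).
by rewrite !scalerBr addrACA -opprD -scalerDl addrC [t + _]addrC subrK scale1r addrC.
Qed.

Lemma coord_translate x v : coord (x + v *m frame_mx) = coord x + v.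
Proof. by rewrite /coord addrAC mulmxDl mulmxK. Qed.

End Frame.

Definition Sw (R : realType) d n lam (p : 'I_n.+1 -> 'rV[R]_d) (w : seq 'I_n.+1) x :=
  foldr (S lam p) x w.

Section Words.
Variables (R : realType) (d n : nat) (lam : R) (p : 'I_n.+1 -> 'rV[R]_d).

Lemma Sw_cat w1 w2 x : Sw lam p (w1 ++ w2) x = Sw lam p w1 (Sw lam p w2 x).
Proof. by rewrite /Sw foldr_cat. Qed.

Lemma S_inverse i x : lam != 0 ->
  x = S lam p i (lam^-1 *: (x - (1 - lam) *: p i)).
Proof. by move=> l0; rewrite /S scalerA mulfV // scale1r subrK. Qed.

Lemma Sw_inverse w x : lam != 0 -> exists y, x = Sw lam p w y.
Proof.
move=> l0; elim: w x => [|i w IH] x; first by exists x.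
have [y yE] := IH (lam^-1 *: (x - (1 - lam) *: p i)).
by exists y; rewrite /= -/(Sw _ _ _ _) -yE -S_inverse.
Qed.

(** The word is reversed because [dig 0], of weight 1, belongs to the innermost map, the last to be
    undone; digits are thus read from the least significant one, as in [ev]. *)
Lemma Sw_levels i0 f (dig : nat -> 'I_n.+1) L x y r : lam != 0 ->
  x = Sw lam p (rev (mkseq dig L)) y ->
  lam^-1 ^+ L * coord p i0 f x 0 r = coord p i0 f y 0 r
    + (lam^-1 - 1) * \sum_(0 <= k < L) lam^-1 ^+ k * coord p i0 f (p (dig k)) 0 r.
Proof.
move=> l0; elim: L x => [|L IH] x.
  by move=> ->; rewrite big_geq // mulr0 addr0 expr0 mul1r.
rewrite mkseqS rev_rcons /= => xE.
rewrite big_nat_recr //= mulrDr addrA -(IH _ erefl) xE coord_comb !mxE exprS.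
by field.
Qed.

End Words.

Lemma sum_nat_blocks (A : nmodType) (F : nat -> A) N m :
  \sum_(0 <= k < N * m) F k = \sum_(0 <= j < N) \sum_(0 <= i < m) F (j * m + i)%N.
Proof.
elim: N => [|N IH]; first by rewrite mul0n !big_geq.
rewrite mulSn addnC big_nat_recr //= -IH (big_cat_nat (n := (N * m)%N)) ?leq_addr //=.
congr (_ + _); rewrite -[X in \sum_(X <= _ < _) _]add0n big_addn addKn.
by apply: eq_bigr => i _; rewrite addnC.
Qed.

(** A level with residue [2 * r + b] modulo [d * 2] serves coordinate [r], through [C r] for [b = 0]
    and [E r] for [b = 1]. A zero bit selects the origin [i0], so no level adds to two
    coordinates. *)
Definition interleaved_digit n d (i0 : 'I_n.+1) (f : 'I_d -> 'I_n.+1)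
    (C E : 'I_d -> seq bool) (k : nat) : 'I_n.+1 :=
  if [pick r : 'I_d | (k %% (d * 2))./2 == r] is Some r then
    if nth false (if odd (k %% (d * 2)) then E r else C r) (k %/ (d * 2))
    then f r else i0
  else i0.

Lemma coord_interleaved_digit (R : realType) d n (p : 'I_n.+1 -> 'rV[R]_d) i0 f C E k r :
  frame_mx p i0 f \in unitmx ->
  coord p i0 f (p (interleaved_digit i0 f C E k)) 0 r =
    ((k %% (d * 2))./2 == r)%:R *
    (nth false (if odd (k %% (d * 2)) then E r else C r) (k %/ (d * 2)))%:R.
Proof.
move=> u; rewrite /interleaved_digit; case: pickP => [s /eqP ks|/(_ r) ->]; last first.
  by rewrite coord_origin mxE mul0r.
have -> : ((k %% (d * 2))./2 == r) = (s == r) by rewrite ks.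
case: eqVneq => [->|sr].
  by case: nth; rewrite ?coord_vertex ?coord_origin // !mxE ?eqxx ?mul1r.
by case: nth; rewrite ?coord_vertex ?coord_origin // !mxE mul0r // eq_sym (negbTE sr) andbF.
Qed.

Lemma interleaved_sum (R : realType) (q : R) d N (r : 'I_d) (c e : seq bool) :
  size c = N -> size e = N ->
  \sum_(0 <= k < N * (d * 2)) q ^+ k * (((k %% (d * 2))./2 == r)%:R *
    (nth false (if odd (k %% (d * 2)) then e else c) (k %/ (d * 2)))%:R) =
  q ^+ (r * 2) * (ev (q ^+ (d * 2)) c + q * ev (q ^+ (d * 2)) e).
Proof.
move=> sc se; have pos (j s : nat) (b : bool) : (s < d)%N ->
    [/\ ((j * (d * 2) + (s * 2 + b)) %% (d * 2) = s * 2 + b)%N,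
        ((s * 2 + b)./2 = s)%N, odd (s * 2 + b) = b
      & ((j * (d * 2) + (s * 2 + b)) %/ (d * 2) = j)%N].
  move=> sd; have lt : (s * 2 + b < d * 2)%N by case: b; lia.
  rewrite modnMDl modn_small // divnMDl ?divn_small ?addn0; [|by []|by lia].
  by split=> //; case: b {lt}; rewrite muln2 ?addn0 ?addn1 /= ?uphalf_double ?doubleK ?odd_double.
rewrite sum_nat_blocks !ev_sum sc se mulr_sumr -big_split /= mulr_sumr.
rewrite big_mkord; apply: eq_bigr => j _; rewrite sum_nat_blocks big_mkord (bigD1 r) //=.
have [m0 h0 o0 d0] := pos j r false (ltn_ord r).
have [m1 h1 o1 d1] := pos j r true (ltn_ord r).
rewrite [X in _ + X]big1 => [|s sr]; last first.
  have [n0 k0 _ _] := pos j s false (ltn_ord s).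
  have [n1 k1 _ _] := pos j s true (ltn_ord s).
  have sr' : (nat_of_ord s == r) = false by apply: negbTE.
  rewrite !big_nat_recr //= big_geq // add0r.
  by rewrite -[0%N]/(nat_of_bool false) -[1%N]/(nat_of_bool true) n0 n1 k0 k1 sr' !mul0r !mulr0 addr0.
rewrite addr0 !big_nat_recr //= big_geq // add0r.
rewrite -[X in (_ + (_ + X))%N]/(nat_of_bool false).
rewrite -[1%N]/(nat_of_bool true) m0 m1 h0 h1 o0 o1 d0 d1 eqxx !mul1r.
rewrite addn0 addn1 !exprD -exprM [(d * 2 * j)%N]mulnC exprS.
by ring.
Qed.

(** * Frames from points in no common hyperplane *)

Lemma hyperplane_of_orthogonal (R : realType) d (A : set 'rV[R]_d) (v x0 : 'rV[R]_d) :
  v != 0 -> (forall x, A x -> v *m (x - x0)^T = 0) -> in_hyperplane A.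
Proof.
move=> v0 H; exists v, (\sum_(k < d) v 0 k * x0 0 k); split=> // x Ax.
have := congr1 (fun M : 'M[R]_(1, 1) => M 0 0) (H x Ax); rewrite !mxE => e.
apply/eqP; rewrite -subr_eq0 -sumrB -{2}e; apply/eqP.
by apply: eq_bigr => k _; rewrite !mxE mulrBr.
Qed.

Lemma frame_unit_nondegenerate (R : realType) d n (p : 'I_n.+1 -> 'rV[R]_d)
    (A : set 'rV[R]_d) i0 f :
  (forall x, A x -> x = p i0 \/ exists r, x = p (f r)) ->
  ~ in_hyperplane A -> frame_mx p i0 f \in unitmx.
Proof.
move=> HA nA; rewrite -unitmx_tr unitmxE unitfE; apply/negP => /det0P[v v0 vW].
apply: nA; apply: (@hyperplane_of_orthogonal R d A v (p i0) v0) => x /HA[->|[r ->]].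
  by rewrite subrr trmx0 mulmx0.
have := congr1 (fun M => M *m delta_mx r (0 : 'I_1)) vW.
by rewrite mul0mx -mulmxA -colE -tr_row rowK.
Qed.

Lemma exists_frame (R : realType) d n (p : 'I_n.+1 -> 'rV[R]_d) :
  ~ in_hyperplane (range p) -> exists f, frame_mx p ord0 f \in unitmx.
Proof.
move=> np; pose A : 'M[R]_(n.+1, d) := \matrix_i (p i - p ord0).
have rA : row_full A.
  apply: contrapT => nA; apply: np.
  have : kermx A^T != 0.
    by rewrite kermx_eq0 /row_free mxrank_tr; apply/negP.
  case/rowV0Pn => v /sub_kermxP vA v0.
  apply: (@hyperplane_of_orthogonal R d _ v (p ord0) v0) => x [i _ <-].
  have := congr1 (fun M => M *m delta_mx i (0 : 'I_1)) vA.
  by rewrite mul0mx -mulmxA -colE -tr_row rowK.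
exists (fullrankfun rA); suff -> : frame_mx p ord0 (fullrankfun rA) = rowsub (fullrankfun rA) A.
  exact: fullrowsub_unit.
by apply/row_matrixP => r; rewrite rowK; apply/rowP => k; rewrite !mxE.
Qed.

Lemma frame_of_subset (R : realType) d n (p : 'I_n.+1 -> 'rV[R]_d) (I : {set 'I_n.+1}) :
  #|I| = d.+1 -> ~ in_hyperplane (p @` [set` I]) ->
  exists i0 f, frame_mx p i0 f \in unitmx /\
    forall i, i \in I -> i = i0 \/ exists r, i = f r.
Proof.
move=> cI nI; pose g (k : 'I_d.+1) : 'I_n.+1 := enum_val (cast_ord (esym cI) k).
have H i : i \in I -> i = g ord0 \/ exists r, i = g (lift ord0 r).
  move=> iI; have gi : g (cast_ord cI (enum_rank_in iI i)) = i.
    by rewrite /g cast_ordK enum_rankK_in.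
  case: (unliftP ord0 (cast_ord cI (enum_rank_in iI i))) gi => [r ->|->] <-; last by left.
  by right; exists r.
exists (g ord0), (fun r => g (lift ord0 r)); split=> //.
apply: frame_unit_nondegenerate nI => x [i iI <-].
by have [->|[r ->]] := H i iI; [left|right; exists r].
Qed.

Lemma sum_delta_row (R : pzSemiRingType) d (r : 'I_d) :
  \sum_s (delta_mx 0 r : 'rV[R]_d) 0 s = 1.
Proof.
rewrite (bigD1 r) //= mxE !eqxx big1 ?addr0 // => s sr.
by rewrite mxE (negbTE sr) andbF.
Qed.

Lemma coord_combE (R : realType) d n (p : 'I_n.+1 -> 'rV[R]_d) i0 f (t : R) x y r :
  coord p i0 f (t *: x + (1 - t) *: y) 0 r =
  t * coord p i0 f x 0 r + (1 - t) * coord p i0 f y 0 r.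
Proof. by rewrite coord_comb; move: (coord _ _ _ x) (coord _ _ _ y) => a b; rewrite !mxE. Qed.

(** * The simplex and the maps undone inside it *)

Section SimplexCoordinates.
Variables (R : realType) (d n : nat) (p : 'I_n.+1 -> 'rV[R]_d).
Variables (i0 : 'I_n.+1) (f : 'I_d -> 'I_n.+1).
Hypothesis frame_unit : frame_mx p i0 f \in unitmx.

Definition simplex : set 'rV[R]_d :=
  [set x | (forall r, 0 <= coord p i0 f x 0 r) /\ \sum_r coord p i0 f x 0 r <= 1].

Lemma chull_simplex (A : set 'rV[R]_d) :
  (forall x, A x -> x = p i0 \/ exists r, x = p (f r)) -> chull A `<=` simplex.
Proof.
move=> HA x; apply; split=> [y /HA[->|[r ->]]|y z t [y0 y1] [z0 z1] t0 t1].
- split=> [r|]; first by rewrite coord_origin mxE.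
  by rewrite big1 // => r _; rewrite coord_origin mxE.
- split=> [s|]; rewrite ?coord_vertex //; first by rewrite mxE.
  by rewrite sum_delta_row.
have u0 : 0 <= 1 - t by rewrite subr_ge0.
split=> [r|]; first by rewrite coord_combE addr_ge0 // mulr_ge0.
rewrite (eq_bigr _ (fun r _ => coord_combE p i0 f t y z r)).
rewrite big_split /= -!mulr_sumr.
by move: (\sum_r _) (\sum_r _) y1 z1 => a b; nra.
Qed.

Lemma interior_move (A : set 'rV[R]_d) x v : interior A x ->
  exists2 e, 0 < e & A (x + e *: v).
Proof.
move=> Ax; have : (fun t : R => x + t *: v) @ (0 : R) --> x + (0 : R) *: v.
  by apply: cvgD; [exact: cvg_cst|apply: cvgZr_tmp; exact: cvg_id].
rewrite scale0r addr0 => /(_ _ Ax) [e /= e0 He].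
exists (e / 2); first by rewrite divr_gt0.
apply: He; rewrite /ball_ /= sub0r normrN gtr0_norm ?divr_gt0 //.
by rewrite ltr_pdivrMr //; lra.
Qed.

Lemma interior_simplex x : interior simplex x ->
  (forall r, 0 < coord p i0 f x 0 r) /\
  ((0 < d)%N -> \sum_r coord p i0 f x 0 r < 1).
Proof.
move=> Ix; have key r (s : R) : exists2 e, 0 < e & simplex (x + (e * s) *: delta_mx 0 r *m frame_mx p i0 f).
  have [e e0 h] := interior_move (s *: delta_mx 0 r *m frame_mx p i0 f) Ix.
  by exists e => //; move: h; rewrite -!scalemxAl scalerA.
split=> [r|d0].
  have [e e0 [h _]] := key r (-1); have := h r.
  by rewrite coord_translate // !mxE !eqxx mulr1 mulrN1 subr_ge0; apply: lt_le_trans.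
have [e e0 [_ h]] := key (Ordinal d0) 1; move: h.
rewrite coord_translate //.
rewrite (eq_bigr (fun r => coord p i0 f x 0 r + e * (delta_mx 0 (Ordinal d0) : 'rV[R]_d) 0 r)).
  rewrite big_split /= -mulr_sumr sum_delta_row mulr1 => h.
  by apply: lt_le_trans h; rewrite ltrDl.
by move=> r _; rewrite !mxE mulr1.
Qed.

End SimplexCoordinates.

Section Greedy.
Variables (R : realType) (d n : nat) (lam : R) (p : 'I_n.+1 -> 'rV[R]_d).
Variables (i0 : 'I_n.+1) (f : 'I_d -> 'I_n.+1).
Hypothesis frame_unit : frame_mx p i0 f \in unitmx.
Hypotheses (lam_gt0 : 0 < lam) (lam_lt1 : lam < 1).
Notation c x r := (coord p i0 f x 0 r).

Lemma coord_S_origin y r : c (S lam p i0 y) r = lam * c y r.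
Proof.
have e : c (p i0) r = 0 by rewrite coord_origin mxE.
by rewrite coord_combE e mulr0 addr0.
Qed.

Lemma coord_S_vertex s y r : c (S lam p (f s) y) r = lam * c y r + (1 - lam) * (r == s)%:R.
Proof.
have e : c (p (f s)) r = (r == s)%:R by rewrite coord_vertex // mxE.
by rewrite coord_combE e.
Qed.

Lemma sum_coord_S_vertex s y :
  \sum_r c (S lam p (f s) y) r = lam * (\sum_r c y r) + (1 - lam).
Proof.
rewrite (eq_bigr _ (fun r _ => coord_S_vertex s y r)) big_split /= -!mulr_sumr.
by congr (_ + _); rewrite (bigD1 s) //= eqxx big1 ?addr0 ?mulr1 // => r /negbTE ->.
Qed.

(* Undoing [S (f r)] multiplies [1 - sum c] by [1 / lam], so only finitely many
   coordinates can be reduced while all of them stay positive. *)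
Lemma greedy_reduction x : (0 < d)%N -> (forall r, 0 < c x r) -> \sum_r c x r < 1 ->
  exists w y, x = Sw lam p w y /\ forall r, 0 < c y r <= 1 - lam.
Proof.
move=> d0 c0 s1; have l0 := lam_gt0; have l1 := lam_lt1.
have q1 : 1 < lam^-1 by rewrite invf_gt1.
have [m] : exists m, 1 < (1 - \sum_r c x r) * lam^-1 ^+ m.
  have [m /(_ m (leqnn m)) h] := @expr_unbounded R lam^-1 (1 / (1 - \sum_r c x r)) q1.
  by exists m; rewrite mulrC -ltr_pdivrMr // subr_gt0.
elim: m x c0 s1 => [|m IH] x c0 s1 hm.
  have : 0 < \sum_r c x r.
    rewrite (bigD1 (Ordinal d0)) //= ltr_wpDr // sumr_ge0 // => r _; exact: ltW.
  by move: hm; rewrite expr0 mulr1; lra.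
have [/forallP h|] := boolP [forall r, c x r <= 1 - lam].
  by exists [::], x; split=> // r; rewrite c0 h.
rewrite negb_forall => /existsP[s]; rewrite -ltNge => hs.
pose y := lam^-1 *: (x - (1 - lam) *: p (f s)).
have xE : x = S lam p (f s) y by apply: S_inverse; rewrite gt_eqF.
have yr r : c x r = lam * c y r + (1 - lam) * (r == s)%:R by rewrite {1}xE coord_S_vertex.
have ys : \sum_r c x r = lam * (\sum_r c y r) + (1 - lam) by rewrite {1}xE sum_coord_S_vertex.
have [|||w [z [yE hz]]] := IH y.
- move=> r; have := yr r; rewrite -(pmulr_rgt0 _ lam_gt0).
  by case: eqP => [->|_] h; [move: hs|move: (c0 r)]; rewrite ?mulr0 ?mulr1 in h *; lra.
- by rewrite -(ltr_pM2l lam_gt0); move: s1; rewrite ys; lra.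
- apply: lt_le_trans hm _; rewrite ys exprS mulrA.
  rewrite ler_wpM2r ?exprn_ge0 ?invr_ge0 ?(ltW lam_gt0) //.
  by rewrite (_ : 1 - _ = lam * (1 - \sum_r c y r)); [rewrite mulrAC mulfV ?mul1r // gt_eqF|ring].
by exists (f s :: w), z; split=> //=; rewrite -/(Sw _ _ _ _) -yE.
Qed.

(** If some coordinate is at least [1 - lam], the map of its vertex can be undone. Otherwise the sum
    is at most [d%:R * (1 - lam)], hence at most [lam], and undoing [S lam p i0] keeps it at most
    1. *)
Lemma simplex_step x : d%:R * (1 - lam) <= lam -> simplex p i0 f x ->
  exists i y, x = S lam p i y /\ simplex p i0 f y.
Proof.
move=> dl [c0 s1]; have l0 := lam_gt0; have l1 := lam_lt1.
have [/existsP[s hs]|] := boolP [exists r, 1 - lam <= c x r].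
  pose y := lam^-1 *: (x - (1 - lam) *: p (f s)).
  have xE : x = S lam p (f s) y by apply: S_inverse; rewrite gt_eqF.
  have yr r : c x r = lam * c y r + (1 - lam) * (r == s)%:R by rewrite {1}xE coord_S_vertex.
  have ys : \sum_r c x r = lam * (\sum_r c y r) + (1 - lam) by rewrite {1}xE sum_coord_S_vertex.
  exists (f s), y; split=> //; split=> [r|].
    have := yr r; rewrite -(pmulr_rge0 _ lam_gt0).
    by case: eqP => [->|_] h; [move: hs|move: (c0 r)]; rewrite ?mulr0 ?mulr1 in h *; lra.
  by rewrite -(ler_pM2l lam_gt0); move: s1; rewrite ys; lra.
rewrite negb_exists => /forallP h.
pose y := lam^-1 *: (x - (1 - lam) *: p i0).
have xE : x = S lam p i0 y by apply: S_inverse; rewrite gt_eqF.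
have yr r : c x r = lam * c y r by rewrite {1}xE coord_S_origin.
exists i0, y; split=> //; split=> [r|].
  by rewrite -(pmulr_rge0 _ lam_gt0) -yr.
rewrite -(ler_pM2l lam_gt0) mulr_sumr -(eq_bigr _ (fun r _ => yr r)) mulr1.
apply: le_trans dl; rewrite mulr_natl -[d in _ *+ d]card_ord -sumr_const.
by apply: ler_sum => r _; apply: ltW; rewrite ltNge h.
Qed.

End Greedy.

(** * Reaching prescribed coordinates *)

(** For large [N] the target [(Q ^+ N * x - t) / kap] lies in the range of [steer]: above [a] since
    [0 < x], and below the upper end since its growth rate [x / kap] is less than [q / (Q - 1)]. *)
Lemma coordinate_control (R : realType) (Q q kap x t eps : R) :
  1 < Q -> Q <= 2 -> 0 < q -> 0 < kap -> 0 < eps -> 0 < x -> x * (Q - 1) < kap * q ->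
  (forall e, 0 < e -> exists u v, 0 < ev Q u - ev Q v < e) ->
  exists N0, forall N, (N0 <= N)%N -> exists c e, [/\ size c = N, size e = N &
    `|Q ^+ N * x - kap * (ev Q c + q * ev Q e) - t| <= eps].
Proof.
move=> Q1 Q2 q0 k0 eps0 x0 hx small.
have [K [a H]] := steer Q1 Q2 q0 (divr_gt0 eps0 k0) small.
have [b1 h1] := @expr_unbounded R Q ((kap * a + t) / x) Q1.
have g0 : 0 < kap * q - x * (Q - 1) by rewrite subr_gt0.
have [b2 h2] := @expr_unbounded R Q
  ((kap * q - (Q - 1) * (kap * a + t)) / (kap * q - x * (Q - 1))) Q1.
exists (maxn K (maxn b1 b2)) => N; rewrite !geq_max => /and3P[KN b1N b2N].
have {}h1 := h1 N b1N; have {}h2 := h2 N b2N.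
rewrite ltr_pdivrMr // in h1; rewrite ltr_pdivrMr // in h2.
have [||c [e [sc se he]]] := H N KN ((Q ^+ N * x - t) / kap).
- by rewrite ler_pdivlMr //; lra.
- have Q10 : 0 < Q - 1 by lra.
  rewrite ler_pdivrMr // ev_onesE // -(ler_pM2r Q10).
  have -> : (a + q * ((Q ^+ N - 1) / (Q - 1))) * kap * (Q - 1) =
     (a * (Q - 1) + q * (Q ^+ N - 1)) * kap by field; rewrite gt_eqF.
  by lra.
exists c, e; split=> //.
have -> : Q ^+ N * x - kap * (ev Q c + q * ev Q e) - t =
   - ((ev Q c + q * ev Q e - (Q ^+ N * x - t) / kap) * kap) by field; rewrite gt_eqF.
by rewrite normrN normrM (gtr0_norm k0) -ler_pdivlMr.
Qed.

Section Reach.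
Variables (R : realType) (d n : nat) (lam : R) (p : 'I_n.+1 -> 'rV[R]_d).
Variables (i0 : 'I_n.+1) (f : 'I_d -> 'I_n.+1).
Hypothesis frame_unit : frame_mx p i0 f \in unitmx.
Hypotheses (lam_gt0 : 0 < lam) (lam_lt1 : lam < 1).
Let q := lam^-1.
Let Q := q ^+ (d * 2).
Hypothesis Q_lt2 : Q < 2.
Hypothesis small : forall e, 0 < e -> exists u v, 0 < ev Q u - ev Q v < e.
Notation c x r := (coord p i0 f x 0 r).

Lemma reach x (t : 'rV[R]_d) eps : (0 < d)%N -> 0 < eps ->
  (forall r, 0 < c x r) -> \sum_r c x r < 1 ->
  exists w y, x = Sw lam p w y /\ forall r, `|c y r - t 0 r| <= eps.
Proof.
move=> d0 eps0 c0 s1; have l0 := lam_gt0; have l1 := lam_lt1; have Q2 := Q_lt2.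
have ql : lam * q = 1 by rewrite /q divff // gt_eqF.
have q1 : 1 < q by rewrite invf_gt1.
have Q1 : 1 < Q by rewrite exprn_egt1 // muln_eq0 negb_or -lt0n d0.
have [w0 [x1 [xE hx1]]] := greedy_reduction frame_unit lam_gt0 lam_lt1 d0 c0 s1.
(* [q - 1] comes from [Sw_levels] and [q ^+ (r * 2)] from the first level serving [r]. After the
   greedy reduction the coordinates are at most [1 - lam], and [Q - 1 < 1], so the growth condition
   of [coordinate_control] holds for every [r]. *)
pose kap (r : 'I_d) := (q - 1) * q ^+ (r * 2).
have kap0 r : 0 < kap r by rewrite mulr_gt0 ?exprn_gt0 //; lra.
have ctl r : exists N0, forall N, (N0 <= N)%N -> exists C E, [/\ size C = N, size E = N &
    `|Q ^+ N * c x1 r - kap r * (ev Q C + q * ev Q E) - t 0 r| <= eps].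
  have /andP[x0 xl] := hx1 r.
  apply: coordinate_control => //; [exact: ltW|lra|].
  have h : c x1 r * (Q - 1) < 1 - lam.
    apply: le_lt_trans (_ : (1 - lam) * (Q - 1) < _); first by rewrite ler_wpM2r //; lra.
    by nra.
  apply: lt_le_trans h _; have e1 : 1 - lam <= q - 1 by nra.
  apply: le_trans e1 _; rewrite /kap -mulrA ler_peMr //; first by lra.
  by rewrite -exprSr exprn_ege1 // ltW.
have [N0 hN0] := choice ctl.
(* The coordinates share their blocks, so one number of blocks must serve them all. *)
pose N := (\max_r N0 r)%N.
have {hN0}ctl r : exists CE : seq bool * seq bool, [/\ size CE.1 = N, size CE.2 = N &
    `|Q ^+ N * c x1 r - kap r * (ev Q CE.1 + q * ev Q CE.2) - t 0 r| <= eps].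
  have [|C [E h]] := hN0 r N; first by rewrite /N (bigD1 r) //= leq_maxl.
  by exists (C, E).
have [CE hCE] := choice ctl.
pose dig := interleaved_digit i0 f (fun r => (CE r).1) (fun r => (CE r).2).
have ln0 : lam != 0 by rewrite gt_eqF.
have [y yE] := Sw_inverse p (rev (mkseq dig (N * (d * 2)))) x1 ln0.
exists (w0 ++ rev (mkseq dig (N * (d * 2)))), y; split; first by rewrite Sw_cat -yE.
move=> r; have [sC sE h] := hCE r; move: h.
have := Sw_levels i0 f r ln0 yE; rewrite -/q.
under eq_bigr => k _ do rewrite coord_interleaved_digit //.
rewrite interleaved_sum //.
rewrite mulnC exprM -/Q => ->.
by congr (`|_| <= _); rewrite /kap; ring.
Qed.

Lemma frame_row_expansion y z : y - z = \sum_r (c y r - c z r) *: row r (frame_mx p i0 f).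
Proof.
rewrite -{1}(coordK frame_unit y) -{1}(coordK frame_unit z) opprD addrACA subrr addr0.
rewrite -mulmxBl mulmx_sum_row; apply: eq_bigr => r _; congr (_ *: _).
by move: (coord _ _ _ y) (coord _ _ _ z) => u v; rewrite !mxE.
Qed.

Lemma frame_bound eps y z : (forall r, `|c y r - c z r| <= eps) ->
  `|y - z| <= eps * \sum_r `|row r (frame_mx p i0 f)|.
Proof.
move=> h; rewrite frame_row_expansion mulr_sumr; apply: le_trans (ler_norm_sum _ _ _) _.
by apply: ler_sum => r _; rewrite normrZ ler_wpM2r.
Qed.

Lemma coord_nbhs z (U : set 'rV[R]_d) : nbhs z U ->
  exists2 eps, 0 < eps & forall y, (forall r, `|c y r - c z r| <= eps) -> U y.
Proof.
move=> /nbhs_ballP[e /= e0 He]; pose S := \sum_r `|row r (frame_mx p i0 f)|.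
have S0 : 0 <= S by apply: sumr_ge0.
have S1 : 0 < S + 1 by lra.
exists (e / 2 / (S + 1)); first by rewrite !divr_gt0.
move=> y /frame_bound h; apply: He; rewrite -ball_normE /ball_ /= distrC.
apply: le_lt_trans h _; rewrite -/S; apply: (@le_lt_trans _ _ (e / 2)); last by lra.
have : 0 <= e / 2 by rewrite divr_ge0 // ltW.
move: (e / 2) => E E0.
by rewrite -mulrA ler_piMr // mulrC ler_pdivrMr // mul1r; lra.
Qed.

Lemma simplex_bounded : exists2 C, 0 < C & forall y, simplex p i0 f y -> `|y| <= C.
Proof.
exists (`|p i0| + \sum_r `|row r (frame_mx p i0 f)| + 1).
  by rewrite ltr_wpDl // addr_ge0 // sumr_ge0.
move=> y [y0 y1]; apply: (@le_trans _ _ (`|p i0| + \sum_r `|row r (frame_mx p i0 f)|)); last by lra.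
have -> : y = p i0 + (y - p i0) by rewrite addrC subrK.
apply: le_trans (ler_normD _ _) _; rewrite lerD2l -[X in _ <= X]mul1r.
apply: frame_bound => r; have e : c (p i0) r = 0 by rewrite coord_origin mxE.
rewrite e subr0 ger0_norm //; apply: le_trans y1.
by rewrite (bigD1 r) //= lerDl sumr_ge0.
Qed.

Lemma simplex_interior : (0 < d)%N -> exists z, interior (simplex p i0 f) z.
Proof.
(* All coordinates of [z] are [h]; those of nearby points lie between 0 and [2 * h], and their sum
   is at most 1. *)
move=> d0; pose h : R := (2 * d%:R)^-1.
have d1 : 0 < d%:R :> R by rewrite ltr0n.
have h0 : 0 < h by rewrite invr_gt0 mulr_gt0.
pose z := p i0 + const_mx h *m frame_mx p i0 f; exists z.
have cz r : c z r = h.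
  by rewrite coord_translate // coord_origin add0r mxE.
pose W := invmx (frame_mx p i0 f).
pose M := \sum_r \sum_k `|W k r|.
have M0 : 0 <= M by apply: sumr_ge0 => r _; apply: sumr_ge0.
have M1 : 0 < M + 1 by lra.
apply/nbhs_ballP; exists (h / (M + 1)) => /=; first by rewrite divr_gt0.
move=> y [_ yz].
have cyz r : `|c y r - h| <= h.
  rewrite -{1}(cz r); have -> : c y r - c z r = \sum_k (y 0 k - z 0 k) * W k r.
    have -> : c y r - c z r = ((y - z) *m W) 0 r.
      have -> : y - z = (y - p i0) - (z - p i0) by rewrite opprB addrA subrK.
      rewrite mulmxBl -/(coord p i0 f y) -/(coord p i0 f z).
      by move: (coord _ _ _ y) (coord _ _ _ z) => u v; rewrite !mxE.
    by rewrite mxE; apply: eq_bigr => k _; rewrite !mxE.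
  apply: le_trans (ler_norm_sum _ _ _) _.
  apply: (@le_trans _ _ (\sum_k (h / (M + 1)) * `|W k r|)).
    apply: ler_sum => k _; rewrite normrM ler_wpM2r //.
    by have := yz 0 k; rewrite /ball /= distrC => /ltW.
  rewrite -mulr_sumr -mulrA ler_piMr ?(ltW h0) // mulrC ler_pdivrMr // mul1r.
  apply: le_trans (_ : M <= _); last by lra.
  by rewrite /M [X in _ <= X](bigD1 r) //= lerDl sumr_ge0 // => s _; apply: sumr_ge0.
have c01 r : 0 <= c y r <= 2 * h.
  by have := cyz r; rewrite ler_norml => /andP[? ?]; apply/andP; split; lra.
split=> [r|]; first by case/andP: (c01 r).
apply: (@le_trans _ _ (\sum_(r < d) 2 * h)).
  by apply: ler_sum => r _; case/andP: (c01 r).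
suff -> : \sum_(r < d) 2 * h = 1 by [].
by rewrite sumr_const card_ord -mulr_natl /h; field; rewrite gt_eqF.
Qed.

End Reach.

(** * The attractor and universal codings *)

Section IteratedFunctionSystem.
Variables (R : realType) (d n : nat) (lam : R) (p : 'I_n.+1 -> 'rV[R]_d).
Hypotheses (lam_gt0 : 0 < lam) (lam_lt1 : lam < 1).

Lemma Sw_sub w x y : Sw lam p w x - Sw lam p w y = lam ^+ size w *: (x - y).
Proof.
elim: w => [|i w IH] /=; first by rewrite expr0 scale1r.
by rewrite /S opprD addrACA subrr addr0 -scalerBr IH scalerA exprS.
Qed.

Lemma Sw_dist w x y : `|Sw lam p w x - Sw lam p w y| = lam ^+ size w * `|x - y|.
Proof. by rewrite Sw_sub normrZ ger0_norm // exprn_ge0 // ltW. Qed.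

Lemma Sw_nbhs w x (A : set 'rV[R]_d) : nbhs x A -> nbhs (Sw lam p w x) (Sw lam p w @` A).
Proof.
move=> /nbhs_ballP[e /= e0 He]; apply/nbhs_ballP.
have lw : 0 < lam ^+ size w by rewrite exprn_gt0.
exists (lam ^+ size w * e) => /=; first by rewrite mulr_gt0.
move=> y; rewrite -ball_normE /ball_ /= => yx.
have [z zE] := Sw_inverse p w y (lt0r_neq0 lam_gt0); exists z => //.
apply: He; rewrite -ball_normE /ball_ /=.
by move: yx; rewrite zE Sw_dist ltr_pM2l.
Qed.

Lemma geometric_small C e : 0 < e -> exists N, forall j, (N <= j)%N -> lam ^+ j * C < e.
Proof.
move=> e0; have q1 : 1 < lam^-1 by rewrite invf_gt1.
have [N hN] := @expr_unbounded R lam^-1 (C / e) q1; exists N => j /hN.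
by rewrite exprVn ltr_pdivrMr // mulrC ltr_pdivlMr ?exprn_gt0 // mulrC.
Qed.

Lemma geometric_cvg (u : nat -> 'rV[R]_d) x C :
  (forall j, `|u j - x| <= lam ^+ j * C) -> u @ \oo --> x.
Proof.
move=> H; apply/cvgrPdist_lt => e e0; have [N hN] := geometric_small C e0.
by exists N => // j /= /hN h; rewrite distrC; apply: le_lt_trans h.
Qed.

Lemma Scomp_Sw a j x : Scomp lam p a j x = Sw lam p (map a (iota 0 j)) x.
Proof. by rewrite /Scomp /Sw foldr_map. Qed.

Lemma coding_eq a x C (y : nat -> 'rV[R]_d) : (forall j, x = Scomp lam p a j (y j)) ->
  (forall j, `|y j| <= C) -> coding lam p a = x.
Proof.
move=> xE yC; apply: cvg_lim; first exact: norm_hausdorff.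
apply: (@geometric_cvg _ _ C) => j.
rewrite [X in _ - X](xE j) !Scomp_Sw Sw_dist.
by rewrite size_map size_iota sub0r normrN ler_wpM2l // exprn_ge0 // ltW.
Qed.

Variable X : set 'rV[R]_d.
Hypothesis attr : is_attractor lam p X.

Lemma attractor_Sw w x : X x -> X (Sw lam p w x).
Proof.
move=> Xx; elim: w => //= i w IH; have [_ [_ ->]] := attr.
by exists i => //; exists (Sw lam p w x).
Qed.

Lemma attractor_bounded : exists2 C, 0 < C & forall x, X x -> `|x| <= C.
Proof.
have [_ [/compact_bounded/pinfty_ex_gt0[C C0 HC] _]] := attr.
by exists C => // x /HC.
Qed.

Lemma attractor_word m x : X x ->
  exists w y, [/\ size w = m, X y & x = Sw lam p w y].
Proof.
elim: m x => [|m IH] x Xx; first by exists [::], x.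
have : (\bigcup_(i in [set: 'I_n.+1]) (S lam p i @` X)) x.
  by have [_ [_ <-]] := attr.
case=> i _ [z Xz zx]; have [w [y [sw Xy zE]]] := IH z Xz.
by exists (i :: w), y; rewrite /= sw -/(Sw _ _ _ _) -zE.
Qed.

Lemma attractor_limit x : (forall e, 0 < e -> exists2 y, X y & `|x - y| < e) -> X x.
Proof.
move=> H; have [_ [Xc _]] := attr.
have := compact_closed (@norm_hausdorff _ _) Xc; apply => B /nbhs_ballP[e /= e0 eB].
have [y Xy xy] := H e e0; exists y; split=> //.
by apply: eB; rewrite -ball_normE.
Qed.

Lemma coding_tail a j : exists2 y, X y & coding lam p a = Scomp lam p a j y.
Proof.
have [[x0 Xx0] _] := attr; have [C C0 HC] := attractor_bounded.
(* Starting at a point of [X] instead of 0, which may lie outside [X], keeps all tails in [X];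
   [coding_eq] shows that the limit is the same. *)
pose u m := Scomp lam p a m x0.
have tail N m : (N <= m)%N -> exists2 z, X z & u m = Sw lam p (map a (iota 0 N)) z.
  move=> /subnKC mE; exists (Sw lam p (map a (iota N (m - N))) x0).
    exact: attractor_Sw.
  by rewrite /u Scomp_Sw -{1}mE iotaD map_cat Sw_cat add0n.
have ucvg : cvg (u @ \oo).
  apply: cauchy_cvg; apply: cauchy_exP => e e0.
  have [N hN] := geometric_small (2 * C) e0; exists (u N); exists N => // m /= Nm.
  have [z Xz ->] := tail N m Nm; rewrite -ball_normE /ball_ /= /u Scomp_Sw Sw_dist.
  rewrite size_map size_iota; apply: le_lt_trans (hN N (leqnn N)).
  rewrite ler_wpM2l ?exprn_ge0 ?(ltW lam_gt0) //; apply: le_trans (ler_normB _ _) _.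
  by have := HC _ Xx0; have := HC _ Xz; lra.
pose x := lim (u @ \oo).
have xtail i : exists2 y, X y & x = Scomp lam p a i y.
  have [y yE] := Sw_inverse p (map a (iota 0 i)) x (lt0r_neq0 lam_gt0).
  exists y; last by rewrite Scomp_Sw.
  have li : 0 < lam ^+ i by rewrite exprn_gt0.
  apply: attractor_limit => e e0.
  have [N _ hN] := (cvgrPdist_lt _ _).1 ucvg _ (mulr_gt0 li e0).
  have [z Xz zE] := tail i (maxn i N) (leq_maxl _ _); exists z => //.
  have := hN (maxn i N) (leq_maxr _ _).
  rewrite -/x zE yE Sw_dist size_map size_iota.
  by rewrite ltr_pM2l.
have [y hy] := choice (fun i => let: ex_intro2 y Xy E := xtail i in ex_intro _ y (conj Xy E)).
have -> : coding lam p a = x.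
  by apply: (@coding_eq a x C y) => i; [case: (hy i)|apply: HC; case: (hy i)].
exact: xtail.
Qed.

Lemma coding_universal_interior a : universal a -> interior X !=set0 ->
  interior X (coding lam p a).
Proof.
move=> ua [z Xz]; have [C C0 HC] := attractor_bounded.
have /nbhs_ballP[e /= e0 He] := nbhs_interior Xz.
have [N /(_ N (leqnn N)) hN] := geometric_small (2 * C) e0.
have [w [z' [sw Xz' zE]]] := attractor_word N (interior_subset Xz).
have [k hk] := ua w.
have [y Xy ->] := coding_tail a (k + size w)%N.
have wE : map a (iota k (size w)) = w.
  apply: (@eq_from_nth _ ord0); first by rewrite size_map size_iota.
  move=> i; rewrite size_map size_iota => iw.
  by rewrite (nth_map 0%N) ?size_iota // nth_iota // hk.
rewrite Scomp_Sw iotaD map_cat Sw_cat add0n wE.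
have : interior X (Sw lam p w y).
  apply: He; rewrite -ball_normE /ball_ /= zE Sw_dist sw.
  apply: le_lt_trans hN; rewrite ler_wpM2l ?exprn_ge0 ?(ltW lam_gt0) //.
  by apply: le_trans (ler_normB _ _) _; have := HC _ Xz'; have := HC _ Xy; lra.
move=> /(Sw_nbhs (map a (iota 0 k))); apply: filterS => _ [t Xt <-].
exact: attractor_Sw.
Qed.

(** By [simplex_step] a point of the simplex has preimages of every depth in the simplex; replacing
    a deep one by a point of [X] moves the image arbitrarily little. *)
Lemma simplex_sub_attractor i0 f : frame_mx p i0 f \in unitmx ->
  d%:R * (1 - lam) <= lam -> simplex p i0 f `<=` X.
Proof.
move=> fu dl x sx; have [[x0 Xx0] _] := attr.
have [C C0 HC] := simplex_bounded fu.
have words m : exists w y, [/\ size w = m, simplex p i0 f y & x = Sw lam p w y].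
  elim: m x sx => [|m IH] {}x sx; first by exists [::], x.
  have [i [y [-> sy]]] := simplex_step fu lam_gt0 lam_lt1 dl sx.
  have [w [z [sw sz ->]]] := IH y sy.
  by exists (i :: w), z; rewrite /= sw.
apply: attractor_limit => e e0.
have [N /(_ N (leqnn N)) hN] := geometric_small (C + `|x0|) e0.
have [w [y [sw sy ->]]] := words N; exists (Sw lam p w x0); first exact: attractor_Sw.
rewrite Sw_dist sw; apply: le_lt_trans hN; rewrite ler_wpM2l ?exprn_ge0 ?(ltW lam_gt0) //.
by apply: le_trans (ler_normB _ _) _; rewrite lerD2r HC.
Qed.

Fixpoint chain_word (g : nat -> seq 'I_n.+1) k :=
  if k is k'.+1 then chain_word g k' ++ g k' else [::].

Lemma chain_word_take g k m : (k <= m)%N ->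
  exists t, chain_word g m = chain_word g k ++ t.
Proof.
elim: m => [|m IH]; first by rewrite leqn0 => /eqP ->; exists [::].
rewrite leq_eqVlt => /orP[/eqP ->|/IH[t E]]; first by exists [::]; rewrite cats0.
by exists (t ++ g m); rewrite /= E catA.
Qed.

(* A point from which every word can be reached inside a stable set of points has a
   universal coding: concatenate the connections to all words. *)
Lemma universal_coding (Y : set 'rV[R]_d) x : Y `<=` X -> Y x ->
  (forall y w, Y y -> exists u z, y = Sw lam p (u ++ w) z /\ Y z) ->
  exists a, universal a /\ coding lam p a = x.
Proof.
move=> YX Yx step; have [C C0 HC] := attractor_bounded.
(* The extra digit makes every block nonempty, so the chain grows by at least one digit per step
   even when the enumerated word is empty. *)
pose wd k : seq 'I_n.+1 := rcons (odflt [::] (unpickle k)) ord0.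
have ex (yk : 'rV[R]_d * nat) : exists uz : seq 'I_n.+1 * 'rV[R]_d, Y yk.1 ->
    yk.1 = Sw lam p (uz.1 ++ wd yk.2) uz.2 /\ Y uz.2.
  case: yk => y k; have [Yy|nY] := pselect (Y y); last by exists ([::], y).
  by have [v [z h]] := step y (wd k) Yy; exists (v, z).
have [u hu] := choice ex.
pose pt := fix pt k := if k is k'.+1 then (u (pt k', k')).2 else x.
pose g k := (u (pt k, k)).1 ++ wd k.
have Ypt k : Y (pt k) by elim: k => //= k IH; case: (hu (pt k, k) IH).
have xE k : x = Sw lam p (chain_word g k) (pt k).
  elim: k => //= k IH; rewrite Sw_cat /g.
  by have [<- _] := hu (pt k, k) (Ypt k).
have sz k : (k <= size (chain_word g k))%N.
  by elim: k => //= k IH; rewrite !size_cat size_rcons; lia.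
(* The prefix of index [i.+1] has more than [i] digits, so the default is never read. *)
pose a i := nth ord0 (chain_word g i.+1) i.
have aE k i : (i < size (chain_word g k))%N -> a i = nth ord0 (chain_word g k) i.
  move=> ik; rewrite /a; have [ki|ki] := leqP k i.+1.
    by have [t ->] := chain_word_take g ki; rewrite nth_cat ik.
  by have [t ->] := chain_word_take g (ltnW ki); rewrite nth_cat (leq_trans _ (sz i.+1)).
exists a; split.
  move=> w; pose k := pickle w; exists (size (chain_word g k) + size (u (pt k, k)).1)%N => i iw.
  have wE : wd k = rcons w ord0 by rewrite /wd /k pickleK.
  have cE : chain_word g k.+1 = (chain_word g k ++ (u (pt k, k)).1) ++ (w ++ [:: ord0]).
    by rewrite /= /g wE catA cats1.
  rewrite (aE k.+1) cE -size_cat; last by rewrite !size_cat; lia.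
  by rewrite nth_cat ltnNge leq_addr /= addKn nth_cat iw.
have tk j : map a (iota 0 j) = take j (chain_word g j).
  apply: (@eq_from_nth _ ord0); first by rewrite size_map size_iota size_takel.
  move=> i; rewrite size_map size_iota => ij.
  rewrite (nth_map 0%N) ?size_iota // nth_iota // add0n nth_take //.
  by apply: aE; apply: leq_trans ij (sz j).
apply: (@coding_eq a x C (fun j => Sw lam p (drop j (chain_word g j)) (pt j))) => j.
  by rewrite Scomp_Sw tk -Sw_cat cat_take_drop.
by apply: HC; apply: attractor_Sw; apply: YX.
Qed.

End IteratedFunctionSystem.

(** * The contraction ratio and the equality of the two sets *)

(** Otherwise [lam * (1 + d%:R^-1) < 1]; Bernoulli's inequality gives [2 <= (1 + d%:R^-1) ^+ d], and
    the power [d * 2] yields [4 * lam ^+ (d * 2) <= 1]. *)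
Lemma bernoulli_ratio (R : realType) (d : nat) (lam : R) : (0 < d)%N -> 0 < lam ->
  1 < 2 * lam ^+ (d * 2) -> d%:R * (1 - lam) <= lam.
Proof.
move=> d0 l0 h; rewrite leNgt; apply/negP => hl.
have D1 : 0 < d%:R :> R by rewrite ltr0n.
have bern (t : R) m : 0 <= t -> 1 + m%:R * t <= (1 + t) ^+ m.
  move=> t0; elim: m => [|m IH]; first by rewrite mul0r addr0 expr0.
  rewrite exprS -natr1; have m0 : 0 <= m%:R :> R by [].
  have h1 := ler_wpM2l (_ : 0 <= 1 + t) IH; have {}h1 := h1 ltac:(lra).
  apply: le_trans h1; have := mulr_ge0 m0 (sqr_ge0 t).
  by move: (m%:R : R) => M; lra.
have b := bern (d%:R^-1) d (_ : 0 <= d%:R^-1); have {}b : 2 <= (1 + d%:R^-1 : R) ^+ d.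
  by apply: le_trans (b _); rewrite ?invr_ge0 // divff ?gt_eqF //; lra.
have e1 : lam * (1 + d%:R^-1) < 1.
  by rewrite mulrDr mulr1 -(ltr_pM2r D1) mulrDl divfK ?gt_eqF //; lra.
have e2 : (lam * (1 + d%:R^-1)) ^+ (d * 2) <= 1.
  by apply: exprn_ile1; [rewrite mulr_ge0 ?addr_ge0 ?invr_ge0 // ltW|exact: ltW].
move: e2; rewrite exprMn [(1 + _) ^+ _]exprM.
have : 0 <= lam ^+ (d * 2) by rewrite exprn_ge0 // ltW.
by move: (lam ^+ _) ((1 + _) ^+ d) h b => L B h b L0; nra.
Qed.
Theorem theorem6p3 (R : realType) (d n : nat) (p : 'I_n.+1 -> 'rV[R]_d)
  (lam : R) (X : set 'rV[R]_d) :
  (0 < d)%N ->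
  ~ in_hyperplane (range p) ->
  2 `^ (- (2 * d%:R)^-1) < lam -> lam < 1 ->
  ~ pisot (lam ^- (2 * d)) ->
  is_attractor lam p X ->
  (forall x, interior X x ->
     exists I : {set 'I_n.+1},
       #|I| = d.+1 /\ {in I &, injective p} /\
       ~ in_hyperplane (p @` [set` I]) /\
       interior (chull (p @` [set` I])) x) ->
  interior X = X_uni lam p X.
Proof.
move=> d0 np lam_gt lam1 npis attr hconv.
have lam0 : 0 < lam by apply: lt_trans lam_gt; exact: powR_gt0.
have lamQ : 1 < 2 * lam ^+ (d * 2).
  have d1 : 0 < 2 * d%:R :> R by rewrite mulr_gt0 // ltr0n.
  have : (2 `^ (- (2 * d%:R)^-1)) ^+ (d * 2) < lam ^+ (d * 2) :> R.
    by rewrite ltr_pXn2r ?nnegrE ?powR_ge0 ?(ltW lam0) // muln_gt0 d0.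
  rewrite -powR_mulrn ?powR_ge0 // -powRrM natrM [d%:R * 2]mulrC mulNr mulVf ?gt_eqF //.
  by rewrite powR_inv1 //; move: (lam ^+ _) => L; lra.
have lamL0 : 0 < lam ^+ (d * 2) by rewrite exprn_gt0.
have Q2 : lam^-1 ^+ (d * 2) < 2.
  by rewrite exprVn -div1r ltr_pdivrMr.
have Q1 : 1 < lam^-1 ^+ (d * 2).
  by rewrite exprn_egt1 ?invf_gt1 // muln_eq0 negb_or -lt0n d0.
have small := small_differences Q1 Q2.
rewrite -exprVn mulnC in npis; have {}small := small npis.
apply/seteqP; split => [x Xx|x [Xx [a [ua <-]]]].
  split; first exact: interior_subset.
  apply: (universal_coding lam0 lam1 attr (@interior_subset _ X) Xx) => y w Xy.
  have [I [cI [_ [nI yI]]]] := hconv y Xy.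
  have [i0 [f [fu hI]]] := frame_of_subset cI nI.
  have ys : interior (simplex p i0 f) y.
    apply: interiorS yI; apply: (chull_simplex fu) => _ [i iI <-].
    by have [->|[r ->]] := hI i iI; [left|right; exists r].
  have [c0 /(_ d0) s1] := interior_simplex fu ys.
  (* Aiming within [eps] of the image of [y] itself ensures that the point reached is the image
     under [w] of a point of [interior X], from which the next word can be aimed at. *)
  have /(coord_nbhs fu)[eps eps0 He] := Sw_nbhs p lam0 w (nbhs_interior Xy).
  have [u [z [yE hz]]] := reach fu lam0 lam1 Q2 small (coord p i0 f (Sw lam p w y)) d0 eps0 c0 s1.
  have [t Xt zE] := He z hz.
  by exists u, t; rewrite Sw_cat zE.
have [f fu] := exists_frame np.
have [z hz] := simplex_interior fu d0.
apply: (coding_universal_interior lam0 lam1 attr ua); exists z.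
apply: interiorS hz; apply: (simplex_sub_attractor lam0 lam1 attr fu).
exact: bernoulli_ratio.
Qed.
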